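(* Let $q$ be a prime power, let $k\ge 0$ and $n\geq 2k+1$ be integers, let $\mathcal{L}$ be a non-empty set of $k$-spaces in $\mathrm{PG}(n,q)$ with characteristic vector $\chi\in\mathbb{R}^{\Pi_k}$, and let $x$ be the rational number with $|\mathcal{L}|=x\genfrac{[}{]}{0pt}{}{n}{k}$. Fix $i\in\{1,\dots,k+1\}$. Then the following properties are equivalent. 1. $\chi\in\operatorname{Im}(A^T)$. 2. $\chi\in\ker(A)^\perp$. 3. For every $k$-space $\pi$, the number of elements of $\mathcal{L}$ disjoint from $\pi$ is $(x-\chi(\pi))\genfrac{[}{]}{0pt}{}{n-k-1}{k}q^{k^2+k}$. 4. The vector $\chi-x\frac{q^{k+1}-1}{q^{n+1}-1}\mathbf{j}$ is a vector in $V_1$. 5. $\chi\in V_0\perp V_1$. 6. For the given $i$ and any $k$-space $\pi$, the number of elements of $\mathcal{L}$ meeting $\pi$ in a $(k-i)$-space is $$\begin{cases}\left((x-1)\frac{q^{k+1}-1}{q^{k-i+1}-1}+q^i\frac{q^{n-k}-1}{q^i-1}\right)q^{i(i-1)}\genfrac{[}{]}{0pt}{}{n-k-1}{i-1}\genfrac{[}{]}{0pt}{}{k}{i} & \text{if }\pi\in\mathcal{L},\\[2mm] x\genfrac{[}{]}{0pt}{}{n-k-1}{i-1}\genfrac{[}{]}{0pt}{}{k+1}{i}q^{i(i-1)} & \text{if }\pi\notin\mathcal{L}.\end{cases}$$ 7. For every pair of conjugate switching sets $\mathcal{R}$ and $\mathcal{R}'$, we have $|\mathcal{L}\cap\mathcal{R}|=|\mathcal{L}\cap\mathcal{R}'|$.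 If moreover $\mathrm{PG}(n,q)$ admits a $k$-spread, then the following properties are equivalent to the previous ones. 8. $|\mathcal{L}\cap\mathcal{S}|=x$ for every $k$-spread $\mathcal{S}$ in $\mathrm{PG}(n,q)$. 9. $|\mathcal{L}\cap\mathcal{S}|=x$ for every regular $k$-spread $\mathcal{S}$ in $\mathrm{PG}(n,q)$.
   Context: All dimensions are projective: a $k$-space of $\mathrm{PG}(n,q)$ is a projective subspace of dimension $k$ (a $(k+1)$-dimensional vector subspace of $\mathbb{F}_q^{n+1}$); the $(-1)$-space is the empty subspace. Two subspaces are disjoint (skew) if they have no common point. $\Pi_k$ is the set of all $k$-spaces of $\mathrm{PG}(n,q)$; vectors in $\mathbb{R}^{\Pi_k}$ are column vectors and $\mathbf{j}$ is the all-one vector. $\chi(\pi)$ is $1$ if $\pi\in\mathcal{L}$ and $0$ otherwise. $A$ is the incidence matrix of points (rows) versus $k$-spaces (columns) over $\mathbb{R}$. Gaussian binomial coefficients: $\genfrac{[}{]}{0pt}{}{a}{b}=\genfrac{[}{]}{0pt}{}{a}{b}_q=\frac{(q^a-1)\cdots(q^{a-b+1}-1)}{(q^b-1)\cdots(q-1)}$ is the number of $b$-dimensional subspaces of $\mathbb{F}_q^a$; $\genfrac{[}{]}{0pt}{}{a}{0}=1$. In property 6 with $i=k+1$, the product $\frac{q^{k+1}-1}{q^{k-i+1}-1}\genfrac{[}{]}{0pt}{}{k}{i}$ is read as $\genfrac{[}{]}{0pt}{}{k+1}{i}$ (to which it is equal for $i\le k$), and $\genfrac{[}{]}{0pt}{}{k}{k+1}=0$.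 Grassmann scheme: for $0\le i\le k+1$, $A_i$ is the adjacency matrix of the relation $R_i=\{(\pi,\pi')\in\Pi_k\times\Pi_k:\dim(\pi\cap\pi')=k-i\}$. There is an orthogonal decomposition $\mathbb{R}^{\Pi_k}=V_0\perp V_1\perp\dots\perp V_{k+1}$ into maximal common eigenspaces of $A_0,\dots,A_{k+1}$, with $V_0=\langle\mathbf{j}\rangle$, ordered so that the eigenvalue of $A_i$ on $V_j$ is $$P_{ji}=\sum_{s=\max(0,j-i)}^{\min(j,k+1-i)}(-1)^{j+s}\genfrac{[}{]}{0pt}{}{j}{s}\genfrac{[}{]}{0pt}{}{n-k+s-j}{n-k-i}\genfrac{[}{]}{0pt}{}{k+1-s}{i}q^{i(i+s-j)+\binom{j-s}{2}}.$$ A partial $k$-spread is a set of mutually disjoint $k$-spaces; a $k$-spread is a partial $k$-spread partitioning the point set of $\mathrm{PG}(n,q)$ (it exists iff $(k+1)\mid(n+1)$). A regular $k$-spread is one obtained by field reduction: with $n+1=t(k+1)$, identify $\mathbb{F}_q^{n+1}$ with $\mathbb{F}_{q^{k+1}}^{t}$ by an $\mathbb{F}_q$-linear isomorphism; the spread consists of the $k$-spaces corresponding to the one-dimensional $\mathbb{F}_{q^{k+1}}$-subspaces. A pair of conjugate switching sets is a pair of partial $k$-spreads $\mathcal{R},\mathcal{R}'$ with $\mathcal{R}\cap\mathcal{R}'=\emptyset$ that cover the same set of points. *)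

(* Defs.v *)
From HB Require Import structures.
From mathcomp Require Import all_boot all_order all_algebra all_field.
From mathcomp Require Import reals.

Set Implicit Arguments.
Unset Strict Implicit.
Unset Printing Implicit Defensive.

Import GRing.Theory.
Local Open Scope ring_scope.

(* The base q is an element of an arbitrary field E, so that the coefficient
   can be used over rat as well as over the reals.  The truncated subtraction
   is harmless: when a < b the factor at i = a is q ^+ 0 - 1 = 0. *)
Definition gauss (E : fieldType) (q : E) (a b : nat) : E :=
  \prod_(i < b) ((q ^+ (a - i) - 1) / (q ^+ (b - i) - 1)).

(* (q^(k+1) - 1) / (q^(k-i+1) - 1) * [k, i]; at i = k+1, where the denominator
   vanishes, the product is read as [k+1, i]. *)
Definition gauss_quot (E : fieldType) (q : E) (k i : nat) : E :=
  if i == k.+1 then gauss q k.+1 i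
  else (q ^+ k.+1 - 1) / (q ^+ (k - i).+1 - 1) * gauss q k i.

(* The eigenvalue P_ji.  For j, i <= k+1, 2k+1 <= n and s in the summation
   range, none of the subtractions in the summand truncates. *)
Definition grass_eigenvalue (E : fieldType) (q : E) (n k j i : nat) : E :=
  \sum_(maxn 0 (j - i) <= s < (minn j (k.+1 - i)).+1)
    (-1) ^+ (j + s) * gauss q j s * gauss q (n - k + s - j) (n - k - i)
      * gauss q (k.+1 - s) i * q ^+ (i * (i + s - j) + 'C(j - s, 2)).

(* vector.v keeps the subtype structure of {vspace vT} internal. *)
Section FiniteVspace.
Import VectorInternalTheory.
Variables (F : finFieldType) (vT : vectType F).
HB.instance Definition _ := [Countable of {vspace vT} by <:].
HB.instance Definition _ := [Finite of {vspace vT} by <:].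
End FiniteVspace.

(* The k-spaces of PG(n, q), q = #|F|: dimensions are projective. *)
Definition kspace (F : finFieldType) (n k : nat) : Type :=
  {U : {vspace 'rV[F]_n.+1} | (\dim U == k.+1)%N}.

Definition point (F : finFieldType) (n : nat) : Type := kspace F n 0.

Section Geometry.
Variables (F : finFieldType) (n k : nat).
Implicit Types (U W : kspace F n k) (S T : {set kspace F n k}).

Definition points_of U : {set point F n} :=
  [set p : point F n | (val p <= val U)%VS].

Definition skew_spaces U W : bool := [disjoint points_of U & points_of W].

(* dim (U meet W) = k - i projectively, for i <= k+1. *)
Definition grass_rel (i : nat) U W : bool :=
  (\dim (val U :&: val W)%VS == k.+1 - i)%N.

Definition cover_of S : {set point F n} := \bigcup_(U in S) points_of U.

Definition partial_spread S : Prop :=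
  {in S &, forall U W, U != W -> skew_spaces U W}.

Definition spread S : Prop := partial_spread S /\ cover_of S = setT.

(* Field reduction: K is the extension of degree k+1 of F, and phi identifies
   F^(n+1) with K^t over F.  The members of S are the k-spaces corresponding to
   the lines K w of K^t. *)
Definition regular_spread S : Prop :=
  exists (K : fieldExtType F) (t : nat)
         (phi : {linear 'rV[F]_n.+1 -> {ffun 'I_t -> K}}),
    [/\ \dim {:K} = k.+1, n.+1 = (t * k.+1)%N, bijective phi
      & forall U, U \in S <->
          exists2 w : {ffun 'I_t -> K}, w != 0 &
            forall v, v \in val U <-> exists a : K, phi v = [ffun j => a * w j]].

Definition conjugate_switching_sets S T : Prop :=
  [/\ partial_spread S, partial_spread T, S :&: T = set0
    & cover_of S = cover_of T].

End Geometry.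

Section Vectors.
Variables (R : realType) (F : finFieldType) (n k : nat).

(* The space R^{Pi_k}, coordinates being indexed through enum_val. *)
Definition kvec := 'cV[R]_#|{: kspace F n k}|.

Definition char_vec (L : {set kspace F n k}) : kvec :=
  \col_j (enum_val j \in L)%:R.

Definition all_one : kvec := const_mx 1.

Definition incidence_mx : 'M[R]_(#|{: point F n}|, #|{: kspace F n k}|) :=
  \matrix_(p, j) (enum_val p \in points_of (enum_val j))%:R.

Definition grass_adj (i : nat) : 'M[R]_#|{: kspace F n k}| :=
  \matrix_(j, l) (grass_rel i (enum_val j) (enum_val l))%:R.

(* The maximal common eigenspace V_j of A_0, ..., A_(k+1). *)
Definition grass_eigenspace (j : nat) :
    {vspace 'cV[R]_#|{: kspace F n k}|} :=
  (\bigcap_(i < k.+2)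
     passmx.leigenspace (linfun (mulmx (grass_adj i)))
                        (grass_eigenvalue (#|F|%:R : R) n k j i))%VS.

End Vectors.

(* Membership in the orthogonal complement of W for the standard inner
   product. *)
Definition in_orth (R : realType) (N : nat) (W : {vspace 'cV[R]_N})
    (u : 'cV[R]_N) : Prop :=
  forall v, v \in W -> (u^T *m v) 0 0 = 0.

(* Main.v *)
Require Import Defs.
From HB Require Import structures.
From mathcomp Require Import all_boot all_order all_algebra all_field.
From mathcomp Require Import reals.
From mathcomp Require Import boolp zify ring.

Set Implicit Arguments.
Unset Strict Implicit.
Unset Printing Implicit Defensive.

Import Order.TTheory GRing.Theory Num.Theory.
Local Open Scope ring_scope.

(** Every property is compared with the first one, that the characteristic
   function chi of L has the form U |-> sum of u p over the points p of U.
   For such chi all the counts are computed by exchanging sums: a point sum is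
   mapped by A_i to a combination of itself and of the total of u
   ([grass_op_point_sum]), and a set of disjoint k-spaces meets L in the sum of
   u over the points that it covers.

   The converses all go through one criterion ([in_im_criterion]).  The image of
   the transposed incidence map and its orthogonal complement, the kernel of A,
   are both invariant under the operators A_i.  For a function f on k-spaces let
   f(T) denote the sum of f over the k-spaces through a subspace T.  If f(T')
   vanishes for all T' of dimension less than j, then Moebius inversion in the
   subspace lattice of a j-dimensional T gives (A_i f)(T) = P_ji f(T)
   ([sum_above_grass_op]): the alternating sum defining P_ji is exactly this
   inversion, weighted by the number of k-spaces through T that meet a given
   k-space as prescribed.  A nonzero f in the kernel of A has f(T) = 0 for all T
   of dimension at most 1, hence on the kernel only the eigenvalues P_ji with
   j >= 2 occur.  So a combination M of the A_i whose eigenvalues with j >= 2 are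
   nonzero detects the image: if M chi is in the image, so is chi.

   It remains to find, for each property, such a combination.
   - The intersection numbers and the eigenspaces give A_i - b with b = P_0i or
     P_1i.  For i >= 2 the q-adic valuation of P_ji is a strictly decreasing
     function of j <= i ([grass_eigenvalue_val]), which separates these numbers
     from the other eigenvalues; for i = 1 a closed form does.
   - For spreads and switching sets, the property is averaged over the elements
     of GL(n+1, q) that map a chosen member of the configuration to a given U.
     As GL is transitive on pairs of k-spaces with a given dimension of the
     meet, the average only depends on the numbers (A_i chi)(U)
     ([average_set]).  A regular spread S gives
     chi + (|S| - 1) A_(k+1) chi / P_0(k+1), a constant.
   - For k >= 1 conjugate switching sets exist inside a (2k+1)-space, viewed as K^2
     over the field K with q^(k+1) elements: the lines y = a x,
     against the twisted lines y = a x^q, for a <> 0 ([exists_switching_pair]).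
     The space y = x meets r = (q^(k+1) - 1) / (q - 1) of the twisted lines in
     one point and none of the others, so the average gives
     chi + (r - 1) A_(k+1) chi / P_0(k+1) - r A_k chi / P_0k = 0.
   In the last two cases the eigenvalues with j >= 2 do not vanish because one of
   their terms has a strictly smaller q-adic valuation than the others. *)

(** * Gaussian binomial coefficients *)

Section Gauss.
Variables (E : fieldType) (q : E).
Hypothesis q_not_root : forall m, (0 < m)%N -> q ^+ m - 1 != 0.

Lemma gauss_n0 a : gauss q a 0 = 1.
Proof. by rewrite /gauss big_ord0. Qed.

Lemma gauss_small a b : (a < b)%N -> gauss q a b = 0.
Proof.
move=> lt_ab; rewrite /gauss (bigD1 (Ordinal lt_ab)) //=.
by rewrite subnn expr0 subrr !mul0r.
Qed.

Lemma gaussSS a b :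
  gauss q a.+1 b.+1 = (q ^+ a.+1 - 1) / (q ^+ b.+1 - 1) * gauss q a b.
Proof. by rewrite /gauss big_ord_recl !subn0. Qed.

Lemma gaussS a b :
  gauss q a b.+1 = (q ^+ (a - b) - 1) / (q ^+ b.+1 - 1) * gauss q a b.
Proof.
elim: b a => [|b IHb] a; first by rewrite /gauss big_ord1 big_ord0 mulr1.
case: a => [|a]; first by rewrite !gauss_small // mulr0.
by rewrite !gaussSS IHb subSS; ring.
Qed.

(** The Pascal recursion has no denominators, so it is the form that descends to
   natural numbers. *)
Lemma gauss_pascal a b :
  gauss q a.+1 b.+1 = gauss q a b + q ^+ b.+1 * gauss q a b.+1.
Proof.
have [lt_ab | le_ba] := ltnP a b.
  by rewrite !gauss_small ?mulr0 ?addr0 // ltnS ltnW.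
rewrite gaussSS gaussS -{1}(subnKC le_ba).
have nz := q_not_root (ltn0Sn b); rewrite -addSn exprD; field.
by rewrite nz.
Qed.

Lemma gaussnn a : gauss q a a = 1.
Proof.
elim: a => [|a IHa]; first by rewrite gauss_n0.
by rewrite gaussSS IHa mulr1 divff ?q_not_root.
Qed.

Lemma gauss_sym b c : gauss q (b + c) b = gauss q (b + c) c.
Proof.
wlog le_bc : b c / (b <= c)%N => [IH | ].
  by case/orP: (leq_total b c) => /IH //; rewrite addnC.
rewrite -(subnKC le_bc); elim: (c - b)%N => [|m IH {le_bc}]; first by rewrite addn0.
rewrite addnS addnS.
have nz1 := q_not_root (ltn0Sn (b + m)); have nz2 := q_not_root (ltn0Sn m).
case: b IH nz1 => [|b] IH nz1; first by rewrite !gauss_n0 gaussnn.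
rewrite gaussSS gaussSS -IH (gaussS _ b).
have -> : (b.+1 + (b.+1 + m) - b = (b.+1 + m).+1)%N by lia.
by field; rewrite q_not_root.
Qed.

(** The q-analogue of the alternating sum of a row of Pascal's triangle; it
   drives the Moebius inversion in subspace lattices. *)
Lemma gauss_alternating c :
  \sum_(t < c.+2) (-1) ^+ t * q ^+ 'C(t, 2) * gauss q c.+1 t = 0.
Proof.
rewrite big_ord_recl /= expr0 gauss_n0 mul1r mulr1.
pose u t : E := (-1) ^+ t * q ^+ ('C(t, 2) + t) * gauss q c t.
have step (t : 'I_c.+1) : true ->
    (-1) ^+ (lift ord0 t) * q ^+ 'C(lift ord0 t, 2) * gauss q c.+1 (lift ord0 t)
      = u t.+1 - u t.
  move=> _; rewrite /= /bump add1n gauss_pascal /u binS bin1.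
  by rewrite !exprD exprS; ring.
(* The Pascal recursion makes the sum telescope. *)
rewrite (eq_bigr _ step) -(big_mkord xpredT (fun t => u t.+1 - u t)).
by rewrite telescope_sumr // /u gauss_small // gauss_n0; ring.
Qed.

End Gauss.

(** The Gaussian coefficient at a natural base is itself a natural number; the
   Pascal recursion is the form that shows it to be 1 modulo the base. *)
Fixpoint qbin (q a b : nat) : nat :=
  match a, b with
  | _, 0 => 1
  | 0, _.+1 => 0
  | a'.+1, b'.+1 => (qbin q a' b' + q ^ b * qbin q a' b)%N
  end.

Lemma qbin_mod q a b : (b <= a)%N -> exists t, qbin q a b = (1 + q * t)%N.
Proof.
elim: a b => [|a IHa] [|b] //; try by exists 0%N; rewrite muln0.
by move=> /IHa[t]/= ->; exists (t + q ^ b * qbin q a b.+1)%N; rewrite expnS; lia.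
Qed.

Lemma natr_base_not_root (E : numFieldType) (q : nat) : (1 < q)%N ->
  forall m, (0 < m)%N -> (q%:R : E) ^+ m - 1 != 0.
Proof.
move=> q_gt1 m m_gt0; rewrite subr_eq0 -natrX (eqr_nat E _ 1) -(expn0 q).
by rewrite eqn_exp2l // -lt0n.
Qed.

Lemma gaussE (E : numFieldType) (q : nat) : (1 < q)%N ->
  forall a b, gauss (q%:R : E) a b = (qbin q a b)%:R.
Proof.
move=> q_gt1 a b; have nr := natr_base_not_root E q_gt1.
elim: a b => [|a IHa] [|b]; rewrite ?gauss_n0 //; first by rewrite gauss_small.
by rewrite gauss_pascal // !IHa /= natrD natrM natrX.
Qed.

(** * The eigenvalues of the Grassmann scheme are distinguished q-adically *)

Section Eigenvalues.
Variables (E : numFieldType) (q : nat).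
Hypothesis q_gt1 : (1 < q)%N.

(** The exponent of q in the term s = j - m of the formula for P_ji. *)
Definition eig_val (i m : nat) : nat := (i * (i - m) + 'C(m, 2))%N.

Lemma eig_val_step i u : (u < i)%N -> (eig_val i u.+1 < eig_val i u)%N.
Proof.
move=> lt_ui; rewrite /eig_val binS bin1.
have -> : (i - u = (i - u.+1).+1)%N by lia.
by rewrite mulnS; lia.
Qed.

Lemma eig_val_decr i m u : (m <= i)%N -> (u < m)%N -> (eig_val i m < eig_val i u)%N.
Proof.
elim: m => // m IHm lt_mi; rewrite ltnS leq_eqVlt => /predU1P[->|].
  exact: eig_val_step.
by move/(IHm (ltnW lt_mi)); apply: ltn_trans; apply: eig_val_step.
Qed.

Definition qdiv (e : nat) (x : E) : Prop := exists t : int, x = (q%:Z ^+ e * t)%:~R.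

(** x has q-adic valuation exactly e, with leading digit 1 or -1; unlike plain
   valuations at a composite base, such elements are closed under products. *)
Definition qunit (e : nat) (x : E) : Prop :=
  exists (m : nat) (t : int), x = (q%:Z ^+ e * ((-1) ^+ m + q%:Z * t))%:~R.

Lemma qunit_qdiv e x : qunit e x -> qdiv e x.
Proof. by move=> [m [t ->]]; eexists. Qed.

Lemma qunitM e e' x y : qunit e x -> qunit e' y -> qunit (e + e') (x * y).
Proof.
move=> [m [t ->]] [m' [t' ->]]; exists (m + m')%N.
exists ((-1) ^+ m * t' + (-1) ^+ m' * t + q%:Z * t * t').
by rewrite -intrM !exprD; congr _%:~R; ring.
Qed.

Lemma qunit_not_qdiv e e' x : qunit e x -> (e < e')%N -> ~ qdiv e' x.
Proof.
move=> [m [t ->]] lt_ee' [t' /intr_inj].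
rewrite -(subnKC lt_ee') addSnnS exprD -mulrA exprS.
have nz : q%:Z ^+ e != 0 by rewrite expf_neq0 // eqz_nat; lia.
move=> /(mulfI nz) eq_t.
have : (q%:Z %| (-1) ^+ m)%Z.
  rewrite (_ : (-1) ^+ m = q%:Z * (q%:Z ^+ (e' - e.+1) * t' - t)); first exact: dvdz_mulr.
  by rewrite mulrBr mulrA -eq_t addrK.
by rewrite dvdzE abszX /= exp1n dvdn1; lia.
Qed.

Lemma qunit_neq0 e x : qunit e x -> x != 0.
Proof.
move=> x_unit; apply/eqP => x0; apply: (qunit_not_qdiv x_unit (ltnSn e)).
by exists 0; rewrite mulr0.
Qed.

Lemma qdiv0 e : qdiv e 0.
Proof. by exists 0; rewrite mulr0. Qed.

Lemma qdivD e x y : qdiv e x -> qdiv e y -> qdiv e (x + y).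
Proof. by move=> [t ->] [t' ->]; exists (t + t'); rewrite -intrD mulrDr. Qed.

Lemma qdivN e x : qdiv e x -> qdiv e (- x).
Proof. by move=> [t ->]; exists (- t); rewrite mulrN intrN. Qed.

Lemma qdivM e e' x y : qdiv e x -> qdiv e' y -> qdiv (e + e') (x * y).
Proof.
by move=> [t ->] [t' ->]; exists (t * t'); rewrite -intrM exprD; congr _%:~R; ring.
Qed.

Lemma qdiv_leq e e' x : (e <= e')%N -> qdiv e' x -> qdiv e x.
Proof.
move=> le_ee' [t ->]; exists (q%:Z ^+ (e' - e) * t).
by rewrite mulrA -exprD subnKC.
Qed.

(** The exponents of q in the alternating sum strictly decrease with j - s, so
   the term of smallest s alone determines the q-adic valuation. *)
Lemma grass_eigenvalue_val n k j i :
    (2 * k + 1 <= n)%N -> (j <= k.+1)%N -> (i <= k.+1)%N ->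
  qunit (eig_val i (minn i j)) (grass_eigenvalue (q%:R : E) n k j i).
Proof.
move=> le_n le_j le_i; rewrite /grass_eigenvalue max0n.
have lt_s : (j - i < (minn j (k.+1 - i)).+1)%N by lia.
rewrite big_ltn //.
set e := eig_val _ _; set S := (X in _ + X).
have [t ->] : qdiv e.+1 S.
  rewrite /S big_seq_cond; elim/big_ind: _; [exact: qdiv0 | exact: qdivD |].
  move=> s; rewrite andbT mem_index_iota !(gaussE _ q_gt1) => lt_is.
  apply: (@qdiv_leq _ (eig_val i (j - s))).
    by apply: eig_val_decr; lia.
  rewrite /eig_val (_ : (i + s - j = i - (j - s))%N); last by lia.
  exists ((-1) ^+ (j + s) * (qbin q j s)%:Z
     * (qbin q (n - k + s - j) (n - k - i))%:Z * (qbin q (k.+1 - s) i)%:Z).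
  by rewrite !intrM !rmorphXn /= intrN !pmulrn; ring.
rewrite !(gaussE _ q_gt1).
have [|t1 ->] := @qbin_mod q j (j - i); first by lia.
have [|t2 ->] := @qbin_mod q (n - k + (j - i) - j) (n - k - i); first by lia.
have [|t3 ->] := @qbin_mod q (k.+1 - (j - i)) i; first by lia.
have -> : (i * (i + (j - i) - j) + 'C(j - (j - i), 2) = e)%N.
  by rewrite /e /eig_val (_ : (i + (j - i) - j = i - minn i j)%N); [congr (_ + 'C(_, _))%N|]; lia.
have -> : (-1) ^+ (j + (j - i)) = (-1) ^+ minn i j :> E.
  by rewrite -[LHS]signr_odd -[RHS]signr_odd; congr (_ ^+ (nat_of_bool _)); lia.
exists (minn i j); pose T1 : int := t1; pose T2 : int := t2; pose T3 : int := t3.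
exists ((-1) ^+ minn i j * (T1 + T2 + T3 + q%:Z * (T1 * T2 + T2 * T3 + T1 * T3)
    + q%:Z ^+ 2 * T1 * T2 * T3) + t).
rewrite /T1 /T2 /T3 !(intrD, intrM, rmorphXn) /= intrN exprS.
by rewrite !natrD !natrM !pmulrn; ring.
Qed.

Variables n k : nat.
Hypothesis le_n : (2 * k + 1 <= n)%N.
Local Notation P := (grass_eigenvalue (q%:R : E) n k).

Lemma grass_eigenvalue_neq i j j' : (j <= k.+1)%N -> (i <= k.+1)%N ->
  (j' < minn i j)%N -> P j i != P j' i.
Proof.
move=> le_j le_i lt_j'; apply/eqP => eqP.
apply: (qunit_not_qdiv (grass_eigenvalue_val le_n le_j le_i)); last first.
  by rewrite eqP; apply/qunit_qdiv/grass_eigenvalue_val; lia.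
by apply: eig_val_decr; lia.
Qed.

(** Multiplied by (q - 1)^2, P_j1 depends on j only through two powers of q. *)
Lemma grass_eigenvalue_i1 j : (1 <= j <= k.+1)%N ->
  (q%:R - 1) ^+ 2 * P j 1
  = q%:R ^+ (n + 2 - j) + q%:R ^+ j
    + (q%:R - 1 - q%:R ^+ (n - k).+1 - q%:R ^+ k.+2).
Proof.
case: j => // j /= le_j; set Q : E := q%:R.
have nr : forall m, (0 < m)%N -> Q ^+ m - 1 != 0 := natr_base_not_root E q_gt1.
have -> : P j.+1 1 = Q * gauss Q (n - k) (n - k - 1) * gauss Q (k - j) 1
    - gauss Q j.+1 j * gauss Q (k - j).+1 1.
  rewrite /grass_eigenvalue max0n subSS subn0.
  have lt1 : (j < (minn j.+1 (k.+1 - 1)).+1)%N by lia.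
  rewrite big_ltn //; have -> : (n - k + j - j.+1 = n - k - 1)%N by lia.
  have -> : (1 + j - j.+1 = 0)%N by lia.
  have -> : (j.+1 - j = 1)%N by lia.
  have -> : (k.+1 - j = (k - j).+1)%N by lia.
  rewrite (gaussnn nr) muln0.
  rewrite bin_small //; rewrite expr0 addSn; rewrite addnn exprS; rewrite -mul2n exprM sqrrN expr1n expr1n.
  have [le_kj | lt_jk] := leqP k j.
    rewrite big_geq; last by lia.
    by rewrite [gauss Q (k - j) 1]gauss_small; [ring | lia].
  rewrite big_ltn; last by lia.
  rewrite big_geq; last by lia.
  rewrite addnn -mul2n exprM sqrrN expr1n expr1n (gaussnn nr) subSS subnn.
  have -> : (n - k + j.+1 - j.+1 = n - k)%N by lia.
  by rewrite (_ : (1 * (1 + j.+1 - j.+1) + 'C(0, 2) = 1)%N); [ring | rewrite bin_small; lia].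
have sym m : gauss Q m.+1 m = (Q ^+ m.+1 - 1) / (Q - 1).
  by rewrite -addn1 (gauss_sym nr) addn1 gaussSS gauss_n0 mulr1.
have one m : gauss Q m 1 = (Q ^+ m - 1) / (Q - 1).
  by rewrite gaussS gauss_n0 subn0 mulr1.
have {}sym' : gauss Q (n - k) (n - k - 1) = (Q ^+ (n - k) - 1) / (Q - 1).
  by have := sym (n - k - 1)%N; have -> : ((n - k - 1).+1 = n - k)%N by lia.
rewrite !one sym sym'.
have -> : (n + 2 - j.+1 = (n - k) + (k - j) + 1)%N by lia.
have -> : (k.+2 = j.+1 + (k - j) + 1)%N by lia.
by rewrite !exprD !exprS; field; have := nr 1%N isT.
Qed.

(** For i = 1 the valuations of the P_j1 with j >= 1 all coincide; the closed form
   separates them, since q^(n+1) + q exceeds q^(n+2-j) + q^j for j >= 2. *)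
Lemma grass_eigenvalue_neq1 i j : (1 <= i <= k.+1)%N -> (2 <= j <= k.+1)%N ->
  P j i != P 1 i.
Proof.
move=> /andP[i_gt0 le_i] /andP[j_gt1 le_j].
have [i_gt1 | i_le1] := ltnP 1 i; first by apply: grass_eigenvalue_neq; lia.
have -> : i = 1%N by lia.
apply/eqP => /(congr1 (fun z => (q%:R - 1) ^+ 2 * z)).
rewrite !grass_eigenvalue_i1; try lia.
move/addIr/eqP; rewrite -!natrX -!natrD eqr_nat => /eqP.
have l1 : (q ^ (n + 2 - j) <= q ^ n)%N by rewrite leq_exp2l; lia.
have l2 : (q ^ j <= q ^ n)%N by rewrite leq_exp2l; lia.
by rewrite (_ : (n + 2 - 1 = n.+1)%N) ?expnS ?expn0; [nia | lia].
Qed.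

Lemma grass_eigenvalue0_neq0 i : (i <= k.+1)%N -> P 0 i != 0.
Proof. by move=> le_i; apply/qunit_neq0/grass_eigenvalue_val. Qed.

Lemma eig_val_top j : (2 <= j <= k.+1)%N ->
  (eig_val k.+1 j + k.+1 < eig_val k.+1 0)%N.
Proof.
move=> /andP[j_gt1 le_j].
have le_j2 : (eig_val k.+1 j <= eig_val k.+1 2)%N.
  by move: j_gt1; rewrite leq_eqVlt => /predU1P[-> // | ?]; apply/ltnW/eig_val_decr.
apply: leq_ltn_trans (leq_add le_j2 (leqnn _)) _.
by rewrite /eig_val (_ : 'C(2, 2) = 1%N) // (_ : 'C(0, 2) = 0%N) //; nia.
Qed.

(** The eigenvalues of the equation obtained by averaging over the spreads
   with S elements. *)
Lemma spread_eigenvalue_neq0 j (S : nat) : (2 <= j <= k.+1)%N ->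
    (S * (q ^ k.+1 - 1) = q ^ n.+1 - 1)%N ->
  1 + (S%:R - 1) / P 0 k.+1 * P j k.+1 != 0.
Proof.
move=> le_j eqS; have /andP[j_gt1 le_jk] := le_j.
have nz := grass_eigenvalue0_neq0 (leqnn k.+1).
(* (q^(n+1) - 1) / (q^(k+1) - 1) begins with 1 + q^(k+1) as 2(k+1) <= n+1. *)
have S_unit : qunit k.+1 (S%:R - 1).
  have gt0 e : (0 < q ^ e)%N by rewrite expn_gt0 ltnW.
  have {}eqS : S%:Z * (q%:Z ^+ k.+1 - 1) = q%:Z ^+ n.+1 - 1.
    have PX e : q%:Z ^+ e = (q ^ e)%N by rewrite -[RHS]natz natrX natz.
    rewrite !PX; move: (gt0 k.+1) (gt0 n.+1) eqS.
    by move: (q ^ k.+1)%N (q ^ n.+1)%N => a b; nia.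
  pose m := (n.+1 - (k.+1 + k.+1))%N.
  have def_n : n.+1 = (k.+1 + (k.+1 + m))%N by rewrite /m; lia.
  exists 0%N, (q%:Z ^+ k * (S%:Z - q%:Z ^+ (k.+1 + m) - q%:Z ^+ m)).
  have -> : S%:R - 1 = (S%:Z - 1)%:~R :> E by rewrite intrB.
  congr _%:~R; move: eqS; rewrite def_n !exprD expr0; set B := q%:Z ^+ m.
  rewrite (mulrA q%:Z) -exprS; set X := q%:Z ^+ k.+1 => eqS.
  apply/eqP; rewrite -subr_eq0; set G := (X in X == 0).
  have -> : G = - (X + 1) * (S%:Z * (X - 1) - (X * (X * B) - 1)) by rewrite /G; ring.
  by rewrite eqS subrr mulr0.
apply/eqP => /(congr1 (fun z => P 0 k.+1 * z)).
have -> : P 0 k.+1 * (1 + (S%:R - 1) / P 0 k.+1 * P j k.+1)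
    = P 0 k.+1 + (S%:R - 1) * P j k.+1 by field.
rewrite mulr0 addrC => /eqP; rewrite addr_eq0 => /eqP eq0.
apply: (qunit_not_qdiv (qunitM S_unit (grass_eigenvalue_val le_n le_jk (leqnn _)))).
  by rewrite (minn_idPr le_jk) addnC; apply: eig_val_top.
by rewrite eq0; apply/qdivN/qunit_qdiv; have := grass_eigenvalue_val le_n (leq0n _) (leqnn k.+1).
Qed.

(** The eigenvalues of the equation obtained by averaging over pairs of
   conjugate switching sets cut out by a field automorphism. *)
Lemma switching_eigenvalue_neq0 j (r : nat) : (2 <= j <= k.+1)%N ->
    (r * (q - 1) = q ^ k.+1 - 1)%N ->
  1 + (r%:R - 1) / P 0 k.+1 * P j k.+1 - r%:R / P 0 k * P j k != 0.
Proof.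
move=> le_j eqr; have /andP[j_gt1 le_jk] := le_j.
have nz := grass_eigenvalue0_neq0 (leqnn k.+1).
have nz' := grass_eigenvalue0_neq0 (leqnSn k).
(* r = 1 + q + q^2 + ... has at least two terms, as k > 0. *)
have [c def_r] : exists c, r = (1 + q * (1 + q * c))%N.
  have /eqP : (r * (q - 1) = (\sum_(i < k.+1) q ^ i) * (q - 1))%N.
    by rewrite eqr !subn1 predn_exp mulnC.
  rewrite eqn_pmul2r ?subn_gt0 // => /eqP ->.
  case: k le_jk => [|k']; first by lia.
  move=> _; exists (\sum_(i < k') q ^ i)%N.
  rewrite 2!big_ord_recl /= expn0 mulnDr muln1 !big_distrr /=; congr (_ + (_ + _))%N.
  by apply: eq_bigr => i _; rewrite /bump /= !add1n !expnS.
have r_unit : qunit 1 (r%:R - 1).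
  exists 0%N, c%:Z; have -> : r%:R - 1 = (r%:Z - 1)%:~R :> E by rewrite intrB.
  by congr _%:~R; rewrite def_r; lia.
apply/eqP => /(congr1 (fun z => P 0 k.+1 * P 0 k * z)).
have -> : P 0 k.+1 * P 0 k * (1 + (r%:R - 1) / P 0 k.+1 * P j k.+1 - r%:R / P 0 k * P j k)
    = (r%:R - 1) * P j k.+1 * P 0 k - (r%:R * (P 0 k.+1 * P j k) - P 0 k.+1 * P 0 k).
  by field; rewrite nz nz'.
rewrite mulr0 => /eqP; rewrite subr_eq0 => /eqP eq0.
have val i j' := @grass_eigenvalue_val n k j' i le_n.
have LHS_unit := qunitM (qunitM r_unit (val _ _ le_jk (leqnn _))) (val _ _ (leq0n _) (leqnSn k)).
apply: (qunit_not_qdiv LHS_unit (ltnSn _)); rewrite eq0.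
have top := eig_val_top le_j; rewrite (minn_idPr le_jk) minn0.
apply: qdivD; last apply: qdivN.
  rewrite -[r%:R]/(r%:R); apply: (@qdiv_leq _ (0 + (eig_val k.+1 0 + eig_val k (minn k j)))); last first.
    apply: qdivM; first by exists r%:Z; rewrite expr0 mul1r.
    by apply: qdivM; apply/qunit_qdiv; [have := val k.+1 0%N isT (leqnn _) | apply: val].
  have [lt_kj | le_jk'] := ltnP k j.
    have -> : j = k.+1 by lia.
    rewrite /eig_val binS bin1 (_ : 'C(0, 2) = 0%N) //.
    by rewrite !subnn !subn0; nia.
  rewrite /eig_val (_ : 'C(0, 2) = 0%N) // !subn0.
  have -> : (k.+1 - j = (k - j).+1)%N by lia.
  by nia.
apply: (@qdiv_leq _ (eig_val k.+1 0 + eig_val k 0)); first by lia.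
by apply: qdivM; apply/qunit_qdiv; [have := val k.+1 0%N isT (leqnn _) | have := val k 0%N isT (leqnSn _)].
Qed.

End Eigenvalues.

(** * Counting subspaces *)

Section Counting.
Variables (F : finFieldType) (m : nat).
Notation VS := {vspace 'rV[F]_m}.
Implicit Types (U W X Y Z T M : VS) (v : 'rV[F]_m).
Local Notation q := #|F|.

Lemma card_field_gt1 : (1 < q)%N.
Proof. exact: finNzRing_gt1. Qed.

Definition ext_set Y X Z (r : nat) : {set VS} :=
  [set U | [&& (U <= Z)%VS, \dim U == (\dim Y + r)%N & (U :&: X)%VS == Y]].

Lemma dim_addv_line X v : v \notin X -> \dim (X + <[v]>) = (\dim X).+1.
Proof.
move=> Xv; have v_neq0 : v != 0 by apply: contraNneq Xv => ->; apply: mem0v.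
rewrite dimv_disjoint_sum ?dim_vline ?v_neq0 ?addn1 //.
apply/eqP; rewrite -subv0; apply/subvP => w; rewrite memv_cap memv0.
case/andP => Xw /vlineP[c def_w]; move: Xw; rewrite def_w.
have [-> | c_neq0] := eqVneq c 0; first by rewrite scale0r.
by move/(memvZ c^-1); rewrite scalerA mulVf // scale1r (negPf Xv).
Qed.

(** By the modular law, the condition on (Y, X) passes to (Y + v, X + v) for any
   vector v of U outside X; this is the step of the induction below. *)
Lemma ext_set_line Y X Z r v U : (Y <= X)%VS -> v \notin X ->
  (U \in ext_set (Y + <[v]>) (X + <[v]>) Z r)
    = (U \in ext_set Y X Z r.+1) && (v \in U).
Proof.
move=> sYX Xv; rewrite !inE dim_addv_line; last by apply: contra Xv; apply: subvP.
rewrite addSnnS; case sUZ: (U <= Z)%VS => //=; case: eqP => //= _.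
apply/eqP/andP => [def_U | [/eqP def_Y Uv]].
  have Uv : v \in U.
    have: v \in (Y + <[v]>)%VS by rewrite memvE addvSr.
    by rewrite -def_U memv_cap => /andP[].
  split=> //; rewrite eqEsubv; apply/andP; split; last first.
    by rewrite subv_cap sYX (subv_trans (addvSl Y <[v]>)) // -def_U capvSl.
  have : (U :&: X <= (Y + <[v]>) :&: X)%VS.
    by rewrite -def_U -capvA capvS // subv_cap addvSl subvv.
  rewrite -vspace_modl // (_ : <[v]> :&: X = 0)%VS ?addv0 //.
  apply/eqP; rewrite -subv0; apply/subvP => w.
  rewrite memv_cap memv0 => /andP[/vlineP[c ->]].
  have [-> | c_neq0] := eqVneq c 0; first by rewrite scale0r.
  by move/(memvZ c^-1); rewrite scalerA mulVf // scale1r (negPf Xv).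
by rewrite -vspace_modr -?memvE // def_Y.
Qed.

Lemma card_diffv U Y : (Y <= U)%VS ->
  #|[set v | (v \in U) && (v \notin Y)]| = (q ^ \dim U - q ^ \dim Y)%N.
Proof.
move=> sYU; rewrite -!card_vspace.
have -> : [set v | (v \in U) && (v \notin Y)] = [set v in U] :\: [set v in Y].
  by apply/setP=> v; rewrite !inE andbC.
rewrite cardsD (setIidPr _) ?cardsE //.
by apply/subsetP=> v; rewrite !inE; apply: subvP.
Qed.

(** Double counting of the pairs (v, U) with v in U outside Y. *)
Lemma ext_set_recursion Y X Z r : (Y <= X)%VS -> (X <= Z)%VS ->
  (#|ext_set Y X Z r.+1| * (q ^ (\dim Y + r.+1) - q ^ \dim Y)
   = \sum_(v | (v \in Z) && (v \notin X)) #|ext_set (Y + <[v]>) (X + <[v]>) Z r|)%N.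
Proof.
move=> sYX sXZ; rewrite -sum_nat_const.
have memS U : U \in ext_set Y X Z r.+1 ->
  [/\ (U <= Z)%VS, (\dim U = \dim Y + r.+1)%N & (U :&: X = Y)%VS].
  by rewrite inE => /and3P[? /eqP ? /eqP ?].
transitivity (\sum_(U in ext_set Y X Z r.+1) \sum_(v | (v \in U) && (v \notin Y)) 1)%N.
  apply: eq_bigr => U /memS[_ dimU defY]; rewrite -dimU -card_diffv ?cardsE ?sum1_card //.
  by rewrite -defY capvSl.
rewrite (exchange_big_dep (fun v => (v \in Z) && (v \notin X))) /=; last first.
  move=> U v /memS[sUZ _ defY] /andP[Uv]; rewrite (subvP sUZ) //=.
  by apply: contra => Xv; rewrite -defY memv_cap Uv.
apply: eq_bigr => v /andP[_ Xv]; rewrite sum1_card; apply: eq_card => U.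
have Yv : v \notin Y by apply: contra Xv; apply: subvP.
by rewrite ext_set_line // [LHS]inE /= Yv andbT.
Qed.

(** Subspaces U of Z that meet X in exactly Y: adjoining to both X and Y a
   vector outside X lowers the codimension of Y in U by one. *)
Lemma card_ext_set (E : numFieldType) r Y X Z : (Y <= X)%VS -> (X <= Z)%VS ->
  #|ext_set Y X Z r|%:R
    = q%:R ^+ ((\dim X - \dim Y) * r) * gauss (q%:R : E) (\dim Z - \dim X) r.
Proof.
have nr := natr_base_not_root E card_field_gt1.
elim: r Y X => [|r IHr] Y X sYX sXZ.
  rewrite muln0 gauss_n0 mul1r (_ : ext_set _ _ _ _ = [set Y]) ?cards1 //.
  apply/setP=> U; rewrite !inE addn0; apply/and3P/eqP => [[_ /eqP dimU /eqP defY]|->].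
    by apply/eqP; rewrite eq_sym eqEdim dimU leqnn -{1}defY capvSl.
  by rewrite (subv_trans sYX) // (capv_idPl sYX).
have le_yx := dimvS sYX; have le_xz := dimvS sXZ.
have Q0 m' : q%:R ^+ m' != 0 :> E.
  by rewrite expf_neq0 // pnatr_eq0 -lt0n ltnW ?card_field_gt1.
have nz : ((q ^ (\dim Y + r.+1) - q ^ \dim Y)%N%:R : E) = q%:R ^+ \dim Y * (q%:R ^+ r.+1 - 1).
  by rewrite natrB ?leq_exp2l ?card_field_gt1 ?leq_addr // !natrX exprD; ring.
apply: (@mulIf _ ((q ^ (\dim Y + r.+1) - q ^ \dim Y)%N%:R)); first by rewrite nz mulf_neq0 ?nr.
rewrite -natrM ext_set_recursion // natr_sum.
rewrite (eq_bigr (fun=> q%:R ^+ ((\dim X - \dim Y) * r)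
    * gauss (q%:R : E) (\dim Z - (\dim X).+1) r)); last first.
  move=> v /andP[Zv Xv]; have Yv : v \notin Y by apply: contra Xv; apply: subvP.
  rewrite IHr ?addvS ?subvv //; last by rewrite subv_add sXZ -memvE.
  by rewrite !dim_addv_line // subSS.
rewrite sumr_const -cardsE card_diffv // -[LHS]mulr_natl nz.
rewrite natrB; last by rewrite leq_exp2l ?card_field_gt1 ?le_xz.
rewrite !natrX; have [eq_xz | lt_xz] := eqVneq (\dim X) (\dim Z).
  by rewrite eq_xz subrr subnn (@gauss_small _ _ 0 r.+1) //; ring.
have {lt_xz} [c def_z] : exists c, (\dim Z = \dim X + c.+1)%N.
  by exists (\dim Z - \dim X).-1; lia.
have {le_yx} [a def_x] : exists a, (\dim X = \dim Y + a)%N.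
  by exists (\dim X - \dim Y)%N; lia.
rewrite def_z subnS !addKn def_x addKn gaussSS mulnS !exprD.
by field; have := nr r.+1 isT.
Qed.

Definition through_set T W (d s : nat) : {set VS} :=
  [set U | [&& (T <= U)%VS, \dim U == d & \dim (U :&: W) == s]].

(** A subspace U through T is determined modulo the choice of M = U meet W: the
   modular law turns the two conditions into U meet (W + T) = M + T. *)
Lemma through_set_fibre T W d M : (T :&: W <= M)%VS -> (M <= W)%VS ->
    (\dim T + \dim M <= d + \dim (T :&: W))%N ->
  [set U in through_set T W d (\dim M) | (U :&: W == M)%VS]
    = ext_set (M + T) (W + T) fullv (d + \dim (T :&: W) - \dim T - \dim M).
Proof.
move=> sTWM sMW le_d.
have capMT : (M :&: T = T :&: W)%VS.
  by apply/eqP; rewrite eqEsubv !subv_cap sTWM capvSl capvSr (subv_trans (capvSl _ _)).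
have := dimv_sum_cap M T; rewrite capMT => dimMT.
apply/setP=> U; rewrite !inE subvf /=.
have -> : (\dim (M + T) + (d + \dim (T :&: W) - \dim T - \dim M) = d)%N by lia.
apply/andP/andP => [[/and3P[sTU -> _] /eqP defM] | [-> /eqP defMT]].
  by rewrite -(vspace_modr W sTU) defM.
have sTU : (T <= U)%VS by rewrite (subv_trans (addvSr M T)) // -defMT capvSl.
have defM : (U :&: W = M)%VS.
  have -> : (U :&: W = (U :&: (W + T)) :&: W)%VS.
    by rewrite -capvA; congr (_ :&: _)%VS; rewrite (capv_idPr (addvSl W T)).
  by rewrite defMT -vspace_modl //; apply/addv_idPl.
by rewrite sTU defM eqxx.
Qed.

End Counting.

Section GrassCounting.
Variables (F : finFieldType) (E : numFieldType) (n k : nat).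
Hypothesis le_n : (2 * k + 1 <= n)%N.
Local Notation VS := {vspace 'rV[F]_n.+1}.
Local Notation q := (#|F|%:R : E).

(** The number of k-spaces U through a j-dimensional T with
   dim (U meet W) = k+1-i, where l is the dimension of the meet of T and the
   k-space W; the case distinction is needed as i + l - j is truncated. *)
Definition through_num (i j l : nat) : E :=
  if (j <= i + l)%N then gauss q (k.+1 - l) i * gauss q (n - k + l - j) (n - k - i)
                         * q ^+ (i * (i + l - j))
  else 0.

Lemma card_through_set (T W : VS) i : (\dim T <= k.+1)%N -> \dim W = k.+1 -> (i <= k.+1)%N ->
  #|through_set T W k.+1 (k.+1 - i)|%:R = through_num i (\dim T) (\dim (T :&: W)).
Proof.
move=> le_T dimW le_i; set j := \dim T; set l := \dim (T :&: W).
have nr := natr_base_not_root E (card_field_gt1 F).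
have le_lj : (l <= j)%N by rewrite dimvS ?capvSl.
have le_lk : (l <= k.+1)%N by rewrite -dimW dimvS ?capvSr.
have memP U : U \in through_set T W k.+1 (k.+1 - i) ->
    [/\ (T <= U)%VS, \dim U = k.+1, \dim (U :&: W) = (k.+1 - i)%N,
        (l <= k.+1 - i)%N & (j <= i + l)%N].
  rewrite inE => /and3P[sTU /eqP dimU /eqP dimUW]; split=> //.
    by rewrite -dimUW dimvS // capvS.
  have := dimv_sum_cap T (U :&: W); rewrite capvA (capv_idPl sTU) dimUW.
  have : (\dim (T + (U :&: W)) <= \dim U)%N by rewrite dimvS // subv_add sTU capvSl.
  by rewrite dimU -/l -/j; lia.
rewrite /through_num; case: ifP => le_j; last first.
  rewrite (_ : through_set _ _ _ _ = set0) ?cards0 //.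
  by apply/setP=> U; rewrite in_set0; apply/negP => /memP[]; rewrite le_j.
have [lt_l | le_l] := ltnP (k.+1 - i) l.
  rewrite gauss_small ?mul0r; last by lia.
  rewrite (_ : through_set _ _ _ _ = set0) ?cards0 //.
  by apply/setP=> U; rewrite in_set0; apply/negP => /memP[_ _ _]; lia.
(* Sum over the meet M of U and W, which lies between T meet W and W. *)
pose Ms := ext_set (T :&: W) (T :&: W) W (k.+1 - i - l).
have -> : #|through_set T W k.+1 (k.+1 - i)| =
    (\sum_(M in Ms) #|[set U in through_set T W k.+1 (k.+1 - i) | (U :&: W == M)%VS]|)%N.
  rewrite -sum1_card (partition_big (fun U => U :&: W)%VS [in Ms]) /=.
    by apply: eq_bigr => M _; rewrite -sum1_card; apply: eq_bigl => U; rewrite inE.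
  move=> U /memP[sTU dimU dimUW _ _]; rewrite inE capvSr dimUW subnKC // eqxx /=.
  by rewrite capvC (capv_idPl _) ?eqxx // capvS.
rewrite natr_sum (eq_bigr (fun=> q ^+ (i * (i + l - j)) * gauss q (n - k + l - j) (n - k - i))).
  rewrite sumr_const -[LHS]mulr_natl card_ext_set ?capvSr // subnn mul0n mul1r dimW -/l.
  have -> : (k.+1 - l = (k.+1 - i - l) + i)%N by lia.
  by rewrite (gauss_sym nr); ring.
move=> M; rewrite inE => /and3P[sMW /eqP dimM /eqP defTW].
have {}dimM : \dim M = (k.+1 - i)%N by rewrite dimM -/l; lia.
have sTWM : (T :&: W <= M)%VS by rewrite -defTW capvSl.
rewrite -dimM through_set_fibre // ?dimM -/l -/j; last by lia.
rewrite card_ext_set ?subvf ?addvS //.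
have := dimv_sum_cap M T; have -> : (M :&: T = T :&: W)%VS.
  by apply/eqP; rewrite eqEsubv !subv_cap sTWM capvSl capvSr (subv_trans (capvSl _ _)) ?capvSr.
have := dimv_sum_cap W T; rewrite (capvC W) dimW dimM -/l -/j => dWT dMT.
rewrite dimvf /dim /= mul1n.
have -> : (\dim (W + T) - \dim (M + T) = i)%N by lia.
have -> : (k.+1 + l - j - (k.+1 - i) = i + l - j)%N by lia.
have -> : (n.+1 - \dim (W + T) = (i + l - j) + (n - k - i))%N by lia.
have -> : (n - k + l - j = (i + l - j) + (n - k - i))%N by lia.
by rewrite (gauss_sym nr).
Qed.

(** The entry of the eigenvalue formula with index s counts the k-spaces through
   a fixed j-dimensional T meeting W as prescribed, when dim (T meet W) = s. *)
Lemma grass_eigenvalue_through i j : (j <= k.+1)%N -> (i <= k.+1)%N ->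
  grass_eigenvalue q n k j i
  = \sum_(l < j.+1) gauss q j l * ((-1) ^+ (j - l) * q ^+ 'C(j - l, 2)) * through_num i j l.
Proof.
move=> le_j le_i; rewrite /grass_eigenvalue max0n.
rewrite -(big_mkord xpredT (fun l => gauss q j l * ((-1) ^+ (j - l) * q ^+ 'C(j - l, 2)) * through_num i j l)).
(* Outside the range of s in the eigenvalue formula, no such k-space exists. *)
rewrite (@big_cat_nat _ _ _ (j - i)%N 0%N j.+1) /=; [|lia|lia].
rewrite [X in _ = X + _]big1_seq ?add0r; last first.
  by move=> s; rewrite mem_index_iota => lt_s; rewrite /through_num ifF ?mulr0 //; lia.
rewrite [RHS](@big_cat_nat _ _ _ (minn j (k.+1 - i)%N).+1) /=; [|lia|lia].
rewrite [X in _ = _ + X]big1_seq ?addr0; last first.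
  move=> s; rewrite mem_index_iota => lt_s; rewrite /through_num.
  by rewrite [gauss q (k.+1 - s) i]gauss_small ?mul0r ?if_same ?mulr0 //; lia.
rewrite [LHS]big_nat_cond [RHS]big_nat_cond; apply: eq_bigr => s /andP[lt_s _].
rewrite /through_num ifT; last by lia.
have -> : (-1) ^+ (j + s) = (-1) ^+ (j - s) :> E.
  by rewrite -[LHS]signr_odd -[RHS]signr_odd; congr (_ ^+ (nat_of_bool _)); lia.
by rewrite exprD; ring.
Qed.

End GrassCounting.

(** * Triangular action of the scheme on subspace sums *)

Section Triangular.
Variables (F : finFieldType) (E : numFieldType) (n k : nat).
Hypothesis le_n : (2 * k + 1 <= n)%N.
Local Notation VS := {vspace 'rV[F]_n.+1}.
Local Notation KS := (kspace F n k).
Local Notation q := (#|F|%:R : E).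
Local Notation P := (grass_eigenvalue q n k).
Implicit Types (U W : KS) (T M : VS) (f v : KS -> E).

Lemma dim_kspace m (U : kspace F n m) : \dim (val U) = m.+1.
Proof. by apply/eqP; case: U. Qed.

Lemma kspace_eqP (U W : KS) : (val U <= val W)%VS -> U = W.
Proof.
by move=> sUW; apply/val_inj/eqP; rewrite eqEdim sUW !dim_kspace leqnn.
Qed.

Lemma card_kspace m (A : pred VS) :
  #|[pred U : kspace F n m | A (val U)]| = #|[set U : VS | (\dim U == m.+1) && A U]|.
Proof.
rewrite -(card_imset [pred U : kspace F n m | A (val U)] val_inj).
apply: eq_card => U; rewrite inE; apply/imsetP/andP => [[U' AU' ->] | [dimU AU]].
  by rewrite (valP U').
by exists (Sub U dimU).
Qed.

(** For T ranging over the points this is the incidence map; the larger T filter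
   the functions on k-spaces. *)
Definition sum_above f T : E := \sum_(W : KS | (T <= val W)%VS) f W.

Definition grass_op (i : nat) f U : E := \sum_(W | grass_rel i U W) f W.

Lemma grass_rel_sym i U W : grass_rel i U W = grass_rel i W U.
Proof. by rewrite /grass_rel capvC. Qed.

Lemma card_above_rel i T W : (\dim T <= k.+1)%N -> (i <= k.+1)%N ->
  #|[pred U : KS | (T <= val U)%VS && grass_rel i U W]|%:R
    = through_num F E n k i (\dim T) (\dim (T :&: val W)).
Proof.
move=> le_T le_i; rewrite -card_through_set ?dim_kspace //.
rewrite (card_kspace k (fun M => (T <= M)%VS && (\dim (M :&: val W) == k.+1 - i)%N)).
by congr _%:R; apply: eq_card => U; rewrite !inE andbCA.
Qed.

Lemma sum_interval M T (G : nat -> E) : (M <= T)%VS ->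
  \sum_(M' | (M <= M')%VS && (M' <= T)%VS) G (\dim T - \dim M')%N
  = \sum_(t < (\dim T - \dim M).+1) gauss q (\dim T - \dim M) t * G t.
Proof.
move=> sMT; have le_MT := dimvS sMT; set c := (\dim T - \dim M)%N.
rewrite (partition_big (fun M' : VS => inord (\dim T - \dim M') : 'I_c.+1) xpredT) //=.
apply: eq_bigr => t _.
rewrite (eq_bigr (fun=> G t)) => [|M' /andP[/andP[sMM' sM'T] /eqP <-]]; last first.
  by rewrite inordK // ltnS leq_sub2l ?dimvS.
rewrite sumr_const -[LHS]mulr_natl; congr (_ * _).
have le_t : (t <= c)%N by rewrite -ltnS.
have -> : gauss q c t = gauss q c (c - t).
  have := gauss_sym (natr_base_not_root E (card_field_gt1 F)) (c - t) t.
  by rewrite subnK.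
transitivity (#|ext_set M M T (c - t)|%:R : E); last first.
  by rewrite card_ext_set // subnn mul0n mul1r.
congr _%:R; apply: eq_card => M'; rewrite !inE [in LHS]/in_mem /=.
rewrite andbAC andbC; case sM'T: (M' <= T)%VS; rewrite ?andbF //= andbC.
have := dimvS sM'T; have -> : (M' :&: M == M)%VS = (M <= M')%VS.
  by rewrite capvC; apply/eqP/idP => [<- | /capv_idPl //]; rewrite capvSr.
case sMM': (M <= M')%VS; rewrite ?andbF // !andbT => le_M'T.
have le_MM' := dimvS sMM'.
rewrite -val_eqE /= inordK ?ltnS ?leq_sub2l //; rewrite /c in le_t *.
by apply/eqP/eqP; lia.
Qed.

(** Moebius inversion in the lattice of subspaces of T: if the sums over the
   k-spaces through the proper subspaces of T vanish, the sums over the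
   k-spaces meeting T in M are determined by the one at T. *)
Lemma sum_meeting f T M : (M <= T)%VS ->
    (forall T', (T' <= T)%VS -> (\dim T' < \dim T)%N -> sum_above f T' = 0) ->
  \sum_(W : KS | (T :&: val W == M)%VS) f W
   = (-1) ^+ (\dim T - \dim M) * q ^+ 'C(\dim T - \dim M, 2) * sum_above f T.
Proof.
move=> sMT vanish; have [c] := ubnP (\dim T - \dim M)%N.
elim: c M sMT => // c IHc M sMT; rewrite ltnS => le_c.
have sum_M : sum_above f M =
    \sum_(M' | (M <= M')%VS && (M' <= T)%VS) \sum_(W : KS | (T :&: val W == M')%VS) f W.
  rewrite /sum_above (partition_big (fun W : KS => T :&: val W)%VS
      (fun M' => (M <= M')%VS && (M' <= T)%VS)) /=; last first.
    by move=> W sMW; rewrite subv_cap sMT sMW capvSl.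
  apply: eq_bigr => M' /andP[sMM' _]; apply: eq_bigl => W.
  rewrite andbC; case: eqP => //= def_M'; apply: subv_trans sMM' _.
  by rewrite -def_M' capvSr.
have [eq_MT | neq_MT] := eqVneq M T.
  rewrite {}eq_MT subnn expr0 !mul1r; apply: eq_bigl => W.
  by apply/eqP/idP => [<- | /capv_idPl]; rewrite ?capvSr.
have lt_MT : (\dim M < \dim T)%N.
  by rewrite ltn_neqAle dimvS // andbT; move: neq_MT; rewrite eqEdim sMT -ltnNge; lia.
move: sum_M; rewrite vanish // (bigD1 M) /= ?subvv ?sMT // => /esym/eqP.
rewrite addr_eq0 => /eqP ->; set w := sum_above f T.
(* The claimed values sum to 0 by the alternating identity, which forces the
   value at M once those above M are known. *)
pose G t := (-1) ^+ t * q ^+ 'C(t, 2) * w.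
have := sum_interval G sMT; rewrite (bigD1 M) /= ?subvv ?sMT //.
set S1 := (X in _ + X = _ -> _); set S2 := (X in _ -> - X = _).
have -> : S1 = S2.
  apply: eq_bigr => M' /andP[/andP[sMM' sM'T] neq_M']; rewrite IHc //.
  have : (\dim M < \dim M')%N.
    rewrite ltn_neqAle dimvS // andbT; apply: contraNneq neq_M' => eq_dim.
    by rewrite eq_sym eqEdim sMM' eq_dim /=.
  by lia.
rewrite [X in _ = X -> _](_ : _ = 0); last first.
  have -> : (\dim T - \dim M = (\dim T - \dim M).-1.+1)%N by lia.
  transitivity (w * 0); last by rewrite mulr0.
  rewrite -[X in w * X](gauss_alternating (natr_base_not_root E (card_field_gt1 F)) (\dim T - \dim M).-1).
  by rewrite mulr_sumr; apply: eq_bigr => t _; rewrite /G; ring.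
by move/eqP; rewrite addr_eq0 => /eqP <-.
Qed.

(** Modulo the sums over smaller subspaces, the operators of the scheme act on
   the sums over j-dimensional subspaces by their j-th eigenvalues. *)
Lemma sum_above_grass_op i f T : (\dim T <= k.+1)%N -> (i <= k.+1)%N ->
    (forall T', (T' <= T)%VS -> (\dim T' < \dim T)%N -> sum_above f T' = 0) ->
  sum_above (grass_op i f) T = P (\dim T) i * sum_above f T.
Proof.
move=> le_T le_i vanish; set j := \dim T; set w := sum_above f T.
transitivity (\sum_(W : KS) f W * through_num F E n k i j (\dim (T :&: val W))).
  rewrite /sum_above /grass_op (exchange_big_dep xpredT) //=; apply: eq_bigr => W _.
  by rewrite sumr_const -card_above_rel // mulr_natr.
rewrite (partition_big (fun W : KS => T :&: val W)%VS (fun M => (0 <= M)%VS && (M <= T)%VS)) /=;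
  last by move=> W _; rewrite sub0v capvSl.
pose G t := through_num F E n k i j (j - t) * ((-1) ^+ t * q ^+ 'C(t, 2) * w).
transitivity (\sum_(M | (0 <= M)%VS && (M <= T)%VS) G (\dim T - \dim M)%N).
  apply: eq_bigr => M /andP[_ sMT].
  rewrite /G -sum_meeting // mulr_sumr; have le_M := dimvS sMT.
  by apply: eq_bigr => W /eqP ->; rewrite mulrC /j subKn.
rewrite sum_interval ?sub0v // dimv0 subn0 -/j grass_eigenvalue_through // mulr_suml.
rewrite (reindex_inj rev_ord_inj) /=; apply: eq_bigr => t _.
have le_t : (t <= j)%N by rewrite -ltnS.
rewrite subSS /G subKn //.
have -> : gauss q j (j - t) = gauss q j t.
  have := gauss_sym (natr_base_not_root E (card_field_gt1 F)) (j - t) t.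
  by rewrite subnK.
by ring.
Qed.

End Triangular.

(** * The image of the incidence map *)

Section Orthogonality.
Variables (R : realFieldType) (m n : nat) (B : 'M[R]_(m, n)).

Lemma gram_eq0 p (C : 'M[R]_(n, p)) : C^T *m C = 0 -> C = 0.
Proof.
move=> CC0; apply/matrixP => i j; rewrite mxE; move/matrixP/(_ j j): CC0.
rewrite !mxE => /eqP; rewrite psumr_eq0 => [|l _]; last by rewrite mxE -expr2 sqr_ge0.
by move/allP/(_ i (mem_index_enum _)); rewrite mxE -expr2 sqrf_eq0 => /eqP.
Qed.

Lemma im_ker_eq0 p (Y : 'M[R]_(m, p)) : B *m (B^T *m Y) = 0 -> B^T *m Y = 0.
Proof.
by move=> BBY0; apply: gram_eq0; rewrite trmx_mul trmxK -mulmxA BBY0 mulmx0.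
Qed.

(** B and B B^T have the same column space, so B x = B B^T y is solvable. *)
Lemma im_ker_decomposition (x : 'cV[R]_n) : exists y, B *m (x - B^T *m y) = 0.
Proof.
have : ((B *m x)^T <= B *m B^T)%MS.
  rewrite submxE trmx_mul -mulmxA im_ker_eq0 ?mulmx0 //.
  by rewrite mulmxA mulmx_coker.
case/submxP => D def_D; exists D^T.
by rewrite mulmxBr mulmxA -[B *m x]trmxK def_D !trmx_mul trmxK subrr.
Qed.

End Orthogonality.

Section Image.
Variables (F : finFieldType) (R : realType) (n k : nat).
Hypothesis le_n : (2 * k + 1 <= n)%N.
Local Notation VS := {vspace 'rV[F]_n.+1}.
Local Notation KS := (kspace F n k).
Local Notation PT := (point F n).
Local Notation q := (#|F|%:R : R).
Local Notation P := (grass_eigenvalue q n k).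
Implicit Types (U W : KS) (p : PT) (f v : KS -> R) (u : PT -> R).

Definition point_sum u U : R := \sum_(p : PT | (val p <= val U)%VS) u p.

Definition in_im f : Prop := exists u, forall U, f U = point_sum u U.

Definition in_ker v : Prop := forall p, sum_above v (val p) = 0.

Lemma card_points_sub (T : VS) :
  #|[pred p : PT | (val p <= T)%VS]|%:R = gauss q (\dim T) 1.
Proof.
rewrite (card_kspace 0 (fun M => (M <= T)%VS)).
transitivity (#|ext_set (0 : VS) 0 T 1|%:R : R); last first.
  by rewrite card_ext_set ?sub0v // dimv0 subnn mul0n mul1r subn0.
congr _%:R; apply: eq_card => M; rewrite !inE dimv0 capv0 eqxx andbT.
by rewrite andbC.
Qed.

Lemma gauss_gt0 a b : (b <= a)%N -> 0 < gauss q a b.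
Proof.
move=> /(@qbin_mod #|F|)[t def_t].
by rewrite (gaussE _ (card_field_gt1 F)) def_t ltr0n addn_gt0.
Qed.

Lemma dim_point_cap p (T : VS) : \dim (val p :&: T) = (val p <= T)%VS.
Proof.
case: (boolP (val p <= T)%VS) => [/capv_idPl -> | npT]; first exact: dim_kspace.
apply/eqP; rewrite -leqn0 leqNgt; apply: contra npT => gt0.
have /eqP <- : (val p :&: T == val p)%VS by rewrite eqEdim capvSl dim_kspace.
exact: capvSr.
Qed.

Lemma card_above_point p : #|[pred U : KS | (val p <= val U)%VS]|%:R = gauss q n k.
Proof.
rewrite (card_kspace k (fun M => (val p <= M)%VS)).
transitivity (#|ext_set (val p) (val p) fullv k|%:R : R).
  congr _%:R; apply: eq_card => M; rewrite !inE subvf dim_kspace add1n /=.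
  case: (\dim M == k.+1) => //=.
  by rewrite capvC; apply/idP/eqP => [/capv_idPl | <-] //; rewrite capvSr.
by rewrite card_ext_set ?subvf // subnn mul0n mul1r dimvf /dim /= mul1n dim_kspace subn1.
Qed.

Lemma sum_point_sum u : \sum_U point_sum u U = gauss q n k * \sum_p u p.
Proof.
rewrite /point_sum (exchange_big_dep xpredT) //= mulr_sumr.
by apply: eq_bigr => p _; rewrite sumr_const -(card_above_point p) mulr_natl.
Qed.

Lemma sum_above_points f : \sum_(p : PT) sum_above f (val p) = gauss q k.+1 1 * \sum_U f U.
Proof.
rewrite /sum_above (exchange_big_dep xpredT) //= mulr_sumr.
apply: eq_bigr => U _; rewrite sumr_const -[LHS]mulr_natl; congr (_ * _).
by have := card_points_sub (val U); rewrite dim_kspace.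
Qed.

Lemma grass_eigenvalue1 i : (i <= k.+1)%N ->
  P 1 i = through_num F R n k i 1 1 - through_num F R n k i 1 0.
Proof.
move=> le_i; rewrite grass_eigenvalue_through // big_ord_recl big_ord1 /= /bump /=.
rewrite gauss_n0 (gaussnn (natr_base_not_root R (card_field_gt1 F))).
by rewrite !bin_small //; ring.
Qed.

(** The number of k-spaces through p in relation i to U only depends on whether
   p lies in U. *)
Lemma grass_op_point_sum i u U : (i <= k.+1)%N ->
  grass_op i (point_sum u) U = P 1 i * point_sum u U + through_num F R n k i 1 0 * \sum_p u p.
Proof.
move=> le_i; rewrite /grass_op /point_sum (exchange_big_dep xpredT) //=.
rewrite mulr_sumr [X in X + _]big_mkcond mulr_sumr -big_split /=; apply: eq_bigr => p _.
rewrite sumr_const -[_ *+ #|_|]mulr_natr (eq_card (B := [pred W | (val p <= val W)%VS & grass_rel i W U]));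
  last by move=> W; rewrite !inE andbC grass_rel_sym.
rewrite card_above_rel ?dim_kspace // dim_point_cap grass_eigenvalue1 //.
by case: ifP => _; ring.
Qed.

Lemma in_im_cst c : in_im (fun=> c).
Proof.
have nz : gauss q k.+1 1 != 0 by rewrite gt_eqF ?gauss_gt0.
exists (fun=> c / gauss q k.+1 1) => U; rewrite /point_sum sumr_const -[_ *+ #|_|]mulr_natr.
by rewrite card_points_sub dim_kspace divfK.
Qed.

Lemma in_imD f f' : in_im f -> in_im f' -> in_im (fun U => f U + f' U).
Proof.
move=> [u def_f] [u' def_f']; exists (fun p => u p + u' p) => U.
by rewrite def_f def_f' -big_split.
Qed.

Lemma in_imZ c f : in_im f -> in_im (fun U => c * f U).
Proof.
by move=> [u def_f]; exists (fun p => c * u p) => U; rewrite def_f mulr_sumr.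
Qed.

Lemma eq_in_im f f' : f =1 f' -> in_im f -> in_im f'.
Proof. by move=> eq_f [u def_f]; exists u => U; rewrite -eq_f. Qed.

Lemma in_im_grass_op i f : (i <= k.+1)%N -> in_im f -> in_im (grass_op i f).
Proof.
move=> le_i [u def_f]; have im_u : in_im (point_sum u) by exists u.
have := in_imD (in_imZ (P 1 i) im_u) (in_im_cst (through_num F R n k i 1 0 * \sum_p u p)).
by apply: eq_in_im => U; rewrite -grass_op_point_sum //; apply: eq_bigr.
Qed.

Lemma in_ker_sum v : in_ker v -> \sum_U v U = 0.
Proof.
move=> ker_v; have nz : gauss q k.+1 1 != 0 by rewrite gt_eqF ?gauss_gt0.
by apply: (mulfI nz); rewrite -sum_above_points mulr0 big1.
Qed.

Local Notation A := (incidence_mx R F n k).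

Lemma incidence_trE (y : 'cV[R]_#|{: PT}|) j :
  (A^T *m y) j 0 = point_sum (fun p => y (enum_rank p) 0) (enum_val j).
Proof.
rewrite mxE /point_sum [RHS]big_mkcond /=.
rewrite (reindex (@enum_rank PT)) /=; last exact/onW_bij/enum_rank_bij.
by apply: eq_bigr => p _; rewrite !mxE enum_rankK inE mulr_natl mulrb.
Qed.

Lemma incidenceE (x : 'cV[R]_#|{: KS}|) i :
  (A *m x) i 0 = sum_above (fun U => x (enum_rank U) 0) (val (enum_val i)).
Proof.
rewrite mxE /sum_above [RHS]big_mkcond /=.
rewrite (reindex (@enum_rank KS)) /=; last exact/onW_bij/enum_rank_bij.
by apply: eq_bigr => U _; rewrite !mxE enum_rankK inE mulr_natl mulrb.
Qed.

Lemma grass_adjE i (x : 'cV[R]_#|{: KS}|) j :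
  (grass_adj R F n k i *m x) j 0 = grass_op i (fun U => x (enum_rank U) 0) (enum_val j).
Proof.
rewrite mxE /grass_op [RHS]big_mkcond /=.
rewrite (reindex (@enum_rank KS)) /=; last exact/onW_bij/enum_rank_bij.
by apply: eq_bigr => U _; rewrite !mxE enum_rankK mulr_natl mulrb.
Qed.

Lemma in_imP (x : 'cV[R]_#|{: KS}|) :
  in_im (fun U => x (enum_rank U) 0) <-> exists y, x = A^T *m y.
Proof.
split=> [[u def_x] | [y def_x]].
  exists (\col_i u (enum_val i)); apply/colP => j; rewrite incidence_trE.
  rewrite -[j in LHS]enum_valK def_x; apply: eq_bigr => p _.
  by rewrite mxE enum_rankK.
exists (fun p => y (enum_rank p) 0) => U.
by rewrite def_x incidence_trE enum_rankK.
Qed.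

Lemma in_kerP (x : 'cV[R]_#|{: KS}|) :
  in_ker (fun U => x (enum_rank U) 0) <-> A *m x = 0.
Proof.
split=> [ker_x | Ax0 p].
  by apply/colP => i; rewrite incidenceE ker_x mxE.
by rewrite -(enum_rankK p) -incidenceE Ax0 mxE.
Qed.

Lemma fun_to_vec f : exists x : 'cV[R]_#|{: KS}|, forall U, f U = x (enum_rank U) 0.
Proof. by exists (\col_j f (enum_val j)) => U; rewrite mxE enum_rankK. Qed.

Lemma eq_sum_above f f' (T : VS) : f =1 f' -> sum_above f T = sum_above f' T.
Proof. by move=> eq_f; apply: eq_bigr. Qed.

Lemma eq_grass_op i f f' U : f =1 f' -> grass_op i f U = grass_op i f' U.
Proof. by move=> eq_f; apply: eq_bigr. Qed.

Lemma im_ker_split f : exists a v, [/\ in_im a, in_ker v & forall U, f U = a U + v U].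
Proof.
have [x def_f] := fun_to_vec f; have [y ker_y] := im_ker_decomposition A x.
exists (fun U => (A^T *m y) (enum_rank U) 0), (fun U => (x - A^T *m y) (enum_rank U) 0).
split; [by apply/in_imP; exists y | by apply/in_kerP |].
by move=> U; rewrite !mxE def_f subrKC.
Qed.

Lemma im_ker0 f : in_im f -> in_ker f -> forall U, f U = 0.
Proof.
have [x def_f] := fun_to_vec f => /(eq_in_im def_f)/in_imP[y def_x] ker_f U.
have : A *m x = 0 by apply/in_kerP => p; rewrite -(ker_f p) -(eq_sum_above _ def_f).
by rewrite def_x => /im_ker_eq0 Ay0; rewrite def_f def_x Ay0 mxE.
Qed.

(** A list of pairs (coefficient, i) encodes a combination of the A_i. *)
Definition scheme_op (c : seq (R * nat)) f U : R :=
  \sum_(t <- c) t.1 * grass_op t.2 f U.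

Definition scheme_eigenvalue (c : seq (R * nat)) (j : nat) : R :=
  \sum_(t <- c) t.1 * P j t.2.

Definition scheme_index (c : seq (R * nat)) : bool := all (fun t => t.2 <= k.+1)%N c.

Lemma sum_above_scheme_op c f (T : VS) : scheme_index c -> (\dim T <= k.+1)%N ->
    (forall T' : VS, (\dim T' < \dim T)%N -> sum_above f T' = 0) ->
  sum_above (scheme_op c f) T = scheme_eigenvalue c (\dim T) * sum_above f T.
Proof.
move=> /allP le_c le_T vanish; rewrite /scheme_op [LHS]exchange_big /= mulr_suml.
rewrite [LHS]big_seq [RHS]big_seq; apply: eq_bigr => t c_t.
rewrite -mulr_sumr -mulrA; congr (_ * _).
by apply: sum_above_grass_op; rewrite ?le_c // => T' _; apply: vanish.
Qed.

Lemma sum_above0 f (T : VS) : \dim T = 0%N -> sum_above f T = \sum_U f U.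
Proof.
by move/eqP; rewrite dimv_eq0 => /eqP ->; apply: eq_bigl => U; rewrite sub0v.
Qed.

Lemma sum_above_line v (T : VS) : in_ker v -> \dim T = 1%N -> sum_above v T = 0.
Proof. by move=> ker_v /eqP dimT; apply: (ker_v (Sub T dimT)). Qed.

Lemma in_ker_scheme_op c v : scheme_index c -> in_ker v -> in_ker (scheme_op c v).
Proof.
move=> le_c ker_v p; rewrite sum_above_scheme_op ?dim_kspace // ?ker_v ?mulr0 // => T'.
by rewrite ltnS leqn0 => /eqP dimT'; rewrite sum_above0 // in_ker_sum.
Qed.

Lemma in_im_scheme_op c f : scheme_index c -> in_im f -> in_im (scheme_op c f).
Proof.
move=> + im_f; elim: c => [_|t c IHc /= /andP[le_t /IHc im_c]].
  by apply: eq_in_im (in_im_cst 0) => U; rewrite /scheme_op big_nil.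
have := in_imD (in_imZ t.1 (in_im_grass_op le_t im_f)) im_c.
by apply: eq_in_im => U; rewrite /scheme_op big_cons.
Qed.

(** The scheme operators respect both the image of the transposed incidence map
   and its orthogonal complement, the kernel, and on the kernel they only have
   the eigenvalues with index at least 2. *)
Lemma in_im_criterion c f : scheme_index c ->
    (forall j, (2 <= j <= k.+1)%N -> scheme_eigenvalue c j != 0) ->
  in_im (scheme_op c f) -> in_im f.
Proof.
move=> le_c nz im_cf; have [a [v [im_a ker_v def_f]]] := im_ker_split f.
suff v0 : forall U, v U = 0.
  by apply: eq_in_im im_a => U; rewrite def_f v0 addr0.
have cv0 : forall U, scheme_op c v U = 0.
  apply: im_ker0; last exact: in_ker_scheme_op.
  have := in_imD im_cf (in_imZ (-1) (in_im_scheme_op le_c im_a)); apply: eq_in_im => U.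
  rewrite /scheme_op mulr_sumr -big_split; apply: eq_bigr => t _ /=.
  by rewrite (eq_grass_op _ _ def_f) /grass_op big_split /= mulN1r mulrDr addrC addKr.
(* A nonzero v would have a smallest dimension m of subspaces T where the sums
   do not all vanish; there M acts by its nonzero m-th eigenvalue. *)
have vanish m : forall T : VS, \dim T = m -> (m <= k.+1)%N -> sum_above v T = 0.
  elim/ltn_ind: m => m IHm T dimT le_m.
  have [m_le1 | m_gt1] := leqP m 1.
    case: m m_le1 {IHm le_m} dimT => [|[|//]] _ dimT; first by rewrite sum_above0 ?in_ker_sum.
    exact: sum_above_line.
  have : sum_above (scheme_op c v) T = 0 by apply: big1.
  rewrite sum_above_scheme_op ?dimT // => [/eqP|T' lt_T'].
    by rewrite mulf_eq0 (negPf (nz _ _)) ?m_gt1 //= => /eqP.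
  by apply: (IHm _ lt_T'); rewrite // ltnW // (leq_trans lt_T').
move=> U; rewrite -(vanish k.+1 (val U)) ?dim_kspace // /sum_above (big_pred1 U) // => W.
by apply/idP/eqP => [/kspace_eqP | ->] //; apply: subvv.
Qed.

End Image.

(** * Averaging over the general linear group *)

Lemma cancel_on_basis (F : fieldType) (A B : vectType F) (X : seq A) (Y : seq B)
    (f : {linear A -> B}) (f' : {linear B -> A}) :
  basis_of {:A} X -> map f X = Y -> map f' Y = X -> cancel f f'.
Proof.
move=> bX mapf mapf' v; have /lfunP/(_ v) : (linfun f' \o linfun f = \1)%VF.
  apply/(fullv_lfunP _ _ (span_basis bX)) => z Xz.
  rewrite comp_lfunE id_lfunE !lfunE /=.
  have lt_z : (index z X < size X)%N by rewrite index_mem.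
  have lt_z' : (index z X < size Y)%N by rewrite -mapf size_map.
  rewrite -[in LHS](nth_index 0 Xz) -(nth_map 0 0 f) // mapf.
  by rewrite -(nth_map 0 0 f') // mapf' nth_index.
by rewrite comp_lfunE id_lfunE !lfunE.
Qed.

Lemma linear_of_free_pair (F : fieldType) (A B : vectType F) (X : seq A) (Y : seq B) :
    free X -> free Y -> size X = size Y ->
  exists (f : {linear A -> B}) (f' : {linear B -> A}), map f X = Y /\ map f' Y = X.
Proof.
move=> freeX freeY eq_sz.
have [f mapf] := linear_of_free X Y; have [f' mapf'] := linear_of_free Y X.
by exists f, f'; rewrite mapf ?mapf'.
Qed.

Section Averaging.
Variables (F : finFieldType) (n k : nat).
Hypothesis le_n : (2 * k + 1 <= n)%N.
Local Notation V := 'rV[F]_n.+1.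
Local Notation VS := {vspace V}.
Local Notation KS := (kspace F n k).
Local Notation GL := {'GL_n.+1[F]}.
Implicit Types (g h : GL) (M T : VS) (U W : KS).

Definition gl_space g M : VS := (linfun (mulmxr (GLval g)) @: M)%VS.

Lemma mem_gl_space g M v : (v *m GLval g \in gl_space g M) = (v \in M).
Proof.
apply/idP/idP => [/memv_imgP[w Mw] | Mv].
  by rewrite lfunE /= => /(can_inj (mulmxK (GL_unitmx g))) ->.
by apply/memv_imgP; exists v; rewrite ?lfunE.
Qed.

Lemma gl_spaceP g M T :
  (forall v, (v *m GLval g \in T) = (v \in M)) <-> gl_space g M = T.
Proof.
split=> [eqT | <- v]; last exact: mem_gl_space.
apply/vspaceP => w; rewrite -(mulmxKV (GL_unitmx g) w).
by rewrite mem_gl_space eqT.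
Qed.

Lemma gl_spaceM g h M : gl_space (g * h)%g M = gl_space h (gl_space g M).
Proof. by apply/gl_spaceP => v; rewrite GL_MxE mulmxA !mem_gl_space. Qed.

Lemma gl_space1 M : gl_space 1%g M = M.
Proof. by apply/gl_spaceP => v; rewrite GL_1E mulmx1. Qed.

Lemma gl_space_cap g M T : gl_space g (M :&: T) = (gl_space g M :&: gl_space g T)%VS.
Proof. by apply/gl_spaceP => v; rewrite !memv_cap !mem_gl_space. Qed.

Lemma dim_gl_space g M : \dim (gl_space g M) = \dim M.
Proof.
apply: limg_dim_eq; apply/eqP; rewrite -subv0; apply/subvP => v.
rewrite memv_cap memv_ker lfunE /= memv0 => /andP[_ /eqP v0].
by rewrite -(mulmxK (GL_unitmx g) v) v0 mul0mx.
Qed.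

Lemma gl_kspace_subproof g m (U : kspace F n m) : \dim (gl_space g (val U)) == m.+1.
Proof. by rewrite dim_gl_space dim_kspace. Qed.

Definition gl_kspace g m (U : kspace F n m) : kspace F n m :=
  Sub (gl_space g (val U)) (gl_kspace_subproof g U).

Lemma gl_kspaceM g h m (U : kspace F n m) : gl_kspace (g * h)%g U = gl_kspace h (gl_kspace g U).
Proof. exact/val_inj/gl_spaceM. Qed.

Lemma gl_kspace1 m (U : kspace F n m) : gl_kspace 1%g U = U.
Proof. exact/val_inj/gl_space1. Qed.

Lemma gl_kspaceK g m : cancel (@gl_kspace g m) (@gl_kspace g^-1%g m).
Proof. by move=> U; rewrite -gl_kspaceM mulgV gl_kspace1. Qed.

Lemma gl_kspaceKV g m : cancel (@gl_kspace g^-1%g m) (@gl_kspace g m).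
Proof. by move=> U; rewrite -gl_kspaceM mulVg gl_kspace1. Qed.

Lemma dim_gl_kspace_cap g U W :
  \dim (val (gl_kspace g U) :&: val (gl_kspace g W)) = \dim (val U :&: val W).
Proof. by rewrite -[RHS](dim_gl_space g) gl_space_cap. Qed.

Lemma GL_map_basis (X Y : seq V) : basis_of fullv X -> basis_of fullv Y ->
  size X = size Y -> exists g, map (mulmxr (GLval g)) X = Y.
Proof.
move=> bX bY eq_sz.
have [f [f' [mapf mapf']]] := linear_of_free_pair (basis_free bX) (basis_free bY) eq_sz.
have ff' := cancel_on_basis bX mapf mapf'.
have inv : lin1_mx f *m lin1_mx f' = 1%:M.
  by apply/row_matrixP => i; rewrite !rowE mulmxA !mul_rV_lin1 /= ff' mulmx1.
have [unit_f _] := mulmx1_unit inv.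
by exists (Sub (lin1_mx f) unit_f); rewrite -[RHS]mapf; apply: eq_map => v; rewrite /= mul_rV_lin1.
Qed.

(** Concatenating bases of M meet T, of its complements in M and in T, and of a
   complement of M + T gives a basis adapted to both M and T. *)
Definition pair_basis M T : seq V :=
  vbasis (M :&: T)%VS ++ vbasis (M :\: T)%VS ++ vbasis (T :\: M)%VS ++ vbasis (M + T)^C%VS.

Lemma pair_basisP M T : basis_of fullv (pair_basis M T).
Proof.
have sz (A : VS) : size (vbasis A) = \dim A by apply: size_tuple.
rewrite basisEdim; apply/andP; split.
  rewrite !span_cat !(span_basis (vbasisP _)) addvA [(M :&: T + _)%VS]addvC addv_diff_cap.
  rewrite addvA [(M + (T :\: M))%VS]addvC addv_diff [(T + M)%VS]addvC.
  by rewrite addv_complf.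
rewrite !size_cat !sz dimv_compl.
have := dimv_cap_compl M T; have := dimv_cap_compl T M; have := dimv_sum_cap M T.
have := dimvS (subvf (M + T)); rewrite (capvC T M) => le1 e1 e2 e3.
rewrite !addnA e3 (_ : (\dim M + \dim (T :\: M) = \dim (M + T))%N) ?subnKC //.
by lia.
Qed.

(** Two pairs of subspaces with the same dimensions, also for the meet, are
   equivalent under the linear group. *)
Lemma GL_pair_transitive M T M' T' : \dim M = \dim M' -> \dim T = \dim T' ->
    \dim (M :&: T) = \dim (M' :&: T') ->
  exists g, gl_space g M = M' /\ gl_space g T = T'.
Proof.
move=> dM dT dMT; have sz (A : VS) : size (vbasis A) = \dim A by apply: size_tuple.
have dMdT : \dim (M :\: T) = \dim (M' :\: T').
  by have := dimv_cap_compl M T; have := dimv_cap_compl M' T'; lia.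
have dTdM : \dim (T :\: M) = \dim (T' :\: M').
  have := dimv_cap_compl T M; have := dimv_cap_compl T' M'.
  by rewrite (capvC T) (capvC T'); lia.
have dC : \dim (M + T)^C = \dim (M' + T')^C.
  rewrite !dimv_compl; have := dimv_sum_cap M T; have := dimv_sum_cap M' T'; lia.
have [|g] := GL_map_basis (pair_basisP M T) (pair_basisP M' T').
  by rewrite !size_cat !sz dMT dMdT dTdM dC.
rewrite !map_cat => /eqP; rewrite !eqseq_cat ?size_map ?sz //.
case/and4P => /eqP eq1 /eqP eq2 /eqP eq3 _; exists g.
have img A B : map (mulmxr (GLval g)) (vbasis A) = vbasis B -> gl_space g A = B.
  move=> eqAB; rewrite /gl_space -[A](span_basis (vbasisP _)) limg_span.
  by rewrite -[B](span_basis (vbasisP _)) -eqAB; congr span; apply: eq_map => v; rewrite lfunE.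
have gD A B : gl_space g (A + B) = (gl_space g A + gl_space g B)%VS by apply: limgD.
split.
  by rewrite -[M](addv_diff_cap M T) gD (img _ _ eq1) (img _ _ eq2) addv_diff_cap.
rewrite -[T](addv_diff_cap T M) gD (capvC T) (img _ _ eq1) (img _ _ eq3).
by rewrite (capvC M') addv_diff_cap.
Qed.

Lemma GL_kspace_transitive U W U' W' :
    \dim (val U :&: val W) = \dim (val U' :&: val W') ->
  exists g, gl_kspace g U = U' /\ gl_kspace g W = W'.
Proof.
move=> eq_dim; have [||g [gU gW]] := GL_pair_transitive _ _ eq_dim; rewrite ?dim_kspace //.
by exists g; split; apply: val_inj.
Qed.

Definition meet_index U W : nat := (k.+1 - \dim (val U :&: val W))%N.

Lemma grass_rel_meet_index U0 W0 U W :
  grass_rel (meet_index U0 W0) U W = (\dim (val U :&: val W) == \dim (val U0 :&: val W0)).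
Proof. by rewrite /grass_rel /meet_index subKn // (leq_trans (dimvS (capvSl _ _))) ?dim_kspace. Qed.

(** By transitivity on the pairs in a given relation; the common number a cancels
   in the averages below. *)
Lemma card_GL_pair U0 W0 : exists a : nat, forall U W,
  #|[set g | (gl_kspace g U0 == U) && (gl_kspace g W0 == W)]|
  = if grass_rel (meet_index U0 W0) U W then a else 0%N.
Proof.
exists #|[set g | (gl_kspace g U0 == U0) && (gl_kspace g W0 == W0)]| => U W.
rewrite grass_rel_meet_index; case: eqP => [eq_dim | neq_dim]; last first.
  by apply: eq_card0 => g; rewrite inE; apply/negP => /andP[/eqP gU /eqP gW]; case: neq_dim;
     rewrite -gU -gW dim_gl_kspace_cap.
have [h [hU hW]] := GL_kspace_transitive (esym eq_dim).
pose D := [set g : GL | (gl_kspace g U0 == U0) && (gl_kspace g W0 == W0)].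
transitivity #|(fun g : GL => g * h)%g @: D|; last exact: (card_imset _ (mulIg h)).
apply: eq_card => g; rewrite inE; apply/andP/imsetP => [[/eqP gU /eqP gW] | [g0]].
  exists (g * h^-1)%g; last by rewrite -mulgA mulVg mulg1.
  by rewrite inE !gl_kspaceM gU gW -hU -hW !gl_kspaceK !eqxx.
by rewrite inE => /andP[/eqP g0U /eqP g0W] ->; rewrite !gl_kspaceM g0U g0W hU hW.
Qed.

Variable R : realType.
Local Notation P := (grass_eigenvalue (#|F|%:R : R) n k).

Lemma card_grass_rel i U : (i <= k.+1)%N -> #|[pred W | grass_rel i U W]|%:R = P 0 i.
Proof.
move=> le_i; rewrite grass_eigenvalue_through // big_ord1 /= gauss_n0 bin_small // !mul1r.
have := @card_above_rel _ R _ _ le_n i 0%VS U; rewrite dimv0 cap0v dimv0 => <- //.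
by congr _%:R; apply: eq_card => W; rewrite !inE sub0v /= grass_rel_sym.
Qed.

Lemma card_stabiliser_gt0 U0 U : (0 < #|[set g | gl_kspace g U0 == U]|)%N.
Proof.
have [|g [gU _]] := @GL_kspace_transitive U0 U0 U U; first by rewrite !capvv !dim_kspace.
by apply/card_gt0P; exists g; rewrite inE gU.
Qed.

(** If g runs over the elements mapping U0 to U, then the image of W0 is uniformly
   distributed over the k-spaces in the same relation to U; their number is the
   valency P_0i. *)
Lemma average_pair (f : KS -> R) U0 W0 U :
  \sum_(g | gl_kspace g U0 == U) f (gl_kspace g W0)
  = #|[set g | gl_kspace g U0 == U]|%:R
    * (grass_op (meet_index U0 W0) f U / P 0 (meet_index U0 W0)).
Proof.
set i := meet_index U0 W0; have le_i : (i <= k.+1)%N by apply: leq_subr.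
have nz := @grass_eigenvalue0_neq0 R _ (card_field_gt1 F) n k le_n i le_i.
have sum_set (A : pred GL) (x : R) : \sum_(g | A g) x = #|[set g | A g]|%:R * x.
  by rewrite mulr_natl -sumr_const; apply: eq_bigl => g; rewrite inE.
have [a card_a] := card_GL_pair U0 W0.
have sumE (f' : KS -> R) :
    \sum_(g | gl_kspace g U0 == U) f' (gl_kspace g W0) = a%:R * grass_op i f' U.
  rewrite (partition_big (fun g => gl_kspace g W0) xpredT) //= /grass_op mulr_sumr.
  rewrite [RHS]big_mkcond; apply: eq_bigr => W _.
  rewrite (eq_bigr (fun=> f' W)) => [|g /andP[_ /eqP -> //]].
  rewrite sum_set card_a -/i.
  by case: ifP => _; rewrite ?mul0r.
have cardE : #|[set g | gl_kspace g U0 == U]|%:R = a%:R * P 0 i.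
  rewrite -(card_grass_rel U le_i) -[LHS]mulr1 -sum_set (sumE (fun=> 1)).
  by congr (_ * _); rewrite /grass_op sumr_const; congr _%:R; apply: eq_card => W; rewrite inE.
by rewrite cardE sumE -mulrA [P 0 i * _]mulrC divfK.
Qed.

Lemma average_set (f : KS -> R) (S : {set KS}) U0 U :
  \sum_(g | gl_kspace g U0 == U) \sum_(W in S) f (gl_kspace g W)
  = #|[set g | gl_kspace g U0 == U]|%:R
    * \sum_(W in S) grass_op (meet_index U0 W) f U / P 0 (meet_index U0 W).
Proof.
by rewrite exchange_big mulr_sumr; apply: eq_bigr => W _; apply: average_pair.
Qed.

End Averaging.

(** * Spreads and switching sets *)

Section Spreads.
Variables (F : finFieldType) (n k : nat).
Local Notation V := 'rV[F]_n.+1.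
Local Notation VS := {vspace V}.
Local Notation KS := (kspace F n k).
Local Notation PT := (point F n).
Local Notation GL := {'GL_n.+1[F]}.
Implicit Types (U W : KS) (p : PT) (S T : {set KS}) (v : V) (g : GL).

Lemma point_spanned p : exists2 v, v != 0 & val p = <[v]>%VS.
Proof.
pose v := vpick (val p); exists v.
  by rewrite vpick0 -dimv_eq0 dim_kspace.
apply/esym/eqP; rewrite eqEdim -memvE memv_pick dim_vline dim_kspace.
by rewrite vpick0 -dimv_eq0 dim_kspace.
Qed.

Lemma point_through v : v != 0 -> exists p : PT, val p = <[v]>%VS.
Proof.
move=> v_neq0; have dim_v : \dim <[v]> == 1%N by rewrite dim_vline v_neq0.
by exists (Sub <[v]>%VS dim_v : PT); rewrite SubK.
Qed.

Lemma mem_points_of p U : (p \in points_of U) = (val p <= val U)%VS.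
Proof. by rewrite inE. Qed.

Lemma skew_spacesE U W : skew_spaces U W = (\dim (val U :&: val W) == 0)%N.
Proof.
rewrite dimv_eq0; apply/idP/eqP => [/pred0P skewUW | cap0].
  apply/eqP; rewrite -subv0; apply/subvP => v; rewrite memv_cap memv0 => /andP[Uv Wv].
  apply: contraT => /point_through[p def_p].
  by have := skewUW p; rewrite !inE def_p -!memvE Uv Wv.
apply/pred0P => p; rewrite !inE -subv_cap cap0 subv0 -dimv_eq0 dim_kspace.
by [].
Qed.

Lemma skew_grass_rel U W : skew_spaces U W = grass_rel k.+1 U W.
Proof. by rewrite skew_spacesE /grass_rel subnn. Qed.

Lemma partial_spread_unique S U W p : partial_spread S -> U \in S -> W \in S ->
  p \in points_of U -> p \in points_of W -> U = W.
Proof.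
move=> spS US WS Up Wp; apply: contraTeq Up => neqUW.
by have /pred0P/(_ p) := spS _ _ US WS neqUW; rewrite /= Wp andbT => ->.
Qed.

Lemma sum_cover (A : nmodType) S (u : PT -> A) : partial_spread S ->
  \sum_(U in S) \sum_(p in points_of U) u p = \sum_(p in cover_of S) u p.
Proof.
move=> spS; rewrite (exchange_big_dep [in cover_of S]) /=; last first.
  by move=> U p US Up; apply/bigcupP; exists U.
apply: eq_bigr => p /bigcupP[U US Up]; rewrite (big_pred1 U) // => W.
apply/andP/eqP => [[WS Wp] | -> //].
exact: partial_spread_unique spS WS US Wp Up.
Qed.

Lemma mem_points_gl g p U : (gl_kspace g p \in points_of (gl_kspace g U)) = (p \in points_of U).
Proof.
rewrite !inE /=; apply/subvP/subvP => sub v pv.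
  by rewrite -(mem_gl_space g) sub // mem_gl_space.
by move: pv; rewrite -[v](mulmxKV (GL_unitmx g)) !mem_gl_space => /sub.
Qed.

Definition gl_set g S : {set KS} := [set gl_kspace g U | U in S].

Lemma gl_kspace_inj g m : injective (@gl_kspace F n g m).
Proof. exact/can_inj/gl_kspaceK. Qed.

Lemma gl_set_partial_spread g S : partial_spread S -> partial_spread (gl_set g S).
Proof.
move=> spS _ _ /imsetP[U US ->] /imsetP[W WS ->] neq.
have := spS _ _ US WS; rewrite !skew_spacesE dim_gl_kspace_cap; apply.
by apply: contraNneq neq => ->.
Qed.

Lemma mem_cover_gl g S p : (p \in cover_of (gl_set g S)) = (gl_kspace g^-1%g p \in cover_of S).
Proof.
apply/bigcupP/bigcupP => [[_ /imsetP[U US ->] gUp] | [U US Up]].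
  by exists U => //; rewrite -(mem_points_gl g) gl_kspaceKV.
exists (gl_kspace g U); first exact: imset_f.
by rewrite -(mem_points_gl g) gl_kspaceKV in Up.
Qed.

Lemma gl_set_switching g S T :
  conjugate_switching_sets S T -> conjugate_switching_sets (gl_set g S) (gl_set g T).
Proof.
move=> [spS spT dST cST]; split; try exact: gl_set_partial_spread.
  apply/eqP; rewrite setI_eq0; apply/pred0P => U /=; apply/negP => /andP[].
  move=> /imsetP[U1 SU1 ->] /imsetP[U2 TU2 /gl_kspace_inj eqU].
  by have := in_set0 U1; rewrite -dST inE SU1 eqU TU2.
by apply/setP=> p; rewrite !mem_cover_gl cST.
Qed.

Lemma sum_gl_set (A : nmodType) g S (f : KS -> A) :
  \sum_(U in gl_set g S) f U = \sum_(U in S) f (gl_kspace g U).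
Proof. by rewrite big_imset //= => U W _ _ /gl_kspace_inj. Qed.

Lemma card_inter_sum (A : pzSemiRingType) (L S : {set KS}) :
  #|L :&: S|%:R = \sum_(U in S) (U \in L)%:R :> A.
Proof.
rewrite -sum1_card natr_sum big_mkcond [RHS]big_mkcond; apply: eq_bigr => U _.
by rewrite inE; case: (U \in L); case: (U \in S).
Qed.

Variable R : realType.

Lemma card_points U : #|points_of U|%:R = gauss (#|F|%:R : R) k.+1 1.
Proof.
rewrite -(dim_kspace U) -card_points_sub; congr _%:R; apply: eq_card => p.
by rewrite !inE.
Qed.

Lemma card_cover S : partial_spread S ->
  #|cover_of S|%:R = #|S|%:R * gauss (#|F|%:R : R) k.+1 1.
Proof.
move=> spS; rewrite -sum1_card natr_sum -(sum_cover (fun=> 1%:R)) //.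
rewrite (eq_bigr (fun=> gauss (#|F|%:R : R) k.+1 1)) => [|U _].
  by rewrite sumr_const mulr_natl.
by rewrite -natr_sum sum1_card card_points.
Qed.

Lemma card_spread S : spread S -> (#|S| * (#|F| ^ k.+1 - 1) = #|F| ^ n.+1 - 1)%N.
Proof.
move=> [spS cS]; have gt0 e : (0 < #|F| ^ e)%N by rewrite expn_gt0 ltnW ?card_field_gt1.
have nr := natr_base_not_root R (card_field_gt1 F).
apply/eqP; rewrite -(eqr_nat R) natrM !natrB // !natrX.
have gE m : (#|F|%:R ^+ m - 1 : R) = (#|F|%:R - 1) * gauss (#|F|%:R : R) m 1.
  by rewrite gaussS gauss_n0 subn0 mulr1 mulrC divfK ?(nr 1%N).
rewrite !gE mulrCA -card_cover // cS.
have := card_points_sub R (fullv : VS); rewrite dimvf /dim /= mul1n => <-.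
by apply/eqP; congr (_ * _%:R); apply: eq_card => p; rewrite !inE subvf.
Qed.

End Spreads.

(** Reduction of b modulo a, as q^a = 1 modulo q^a - 1. *)
Lemma dvdn_of_predX q a b : (1 < q)%N -> (0 < a)%N -> (q ^ a - 1 %| q ^ b - 1)%N -> (a %| b)%N.
Proof.
move=> q_gt1 a_gt0; elim/ltn_ind: b => b IHb dvd_b.
have gt0 e : (0 < q ^ e)%N by rewrite expn_gt0 ltnW.
have [le_ab | lt_ba] := leqP a b; last first.
  have lt : (q ^ b < q ^ a)%N by rewrite ltn_exp2l.
  have [b0 | b_gt0] := posnP b; first by rewrite b0.
  have : (q ^ 1 <= q ^ b)%N by rewrite leq_exp2l.
  by have := dvdn_leq _ dvd_b; rewrite expn1; lia.
rewrite -(subnK le_ab) dvdn_addl //; apply: IHb; first by lia.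
move: dvd_b; have -> : (q ^ b - 1 = q ^ (b - a) * (q ^ a - 1) + (q ^ (b - a) - 1))%N.
  have -> : (q ^ b = q ^ (b - a) * q ^ a)%N by rewrite -expnD subnK.
  by have := gt0 (b - a)%N; have := gt0 a; nia.
by rewrite dvdn_addr ?dvdn_mull.
Qed.

(** * Field reduction *)

Section FieldExtensions.
Variable F : finFieldType.
Local Notation q := #|F|.

Lemma frobenius_linear (K : fieldExtType F) :
  exists tau : 'End(K), forall x, tau x = x ^+ q.
Proof.
pose L := FinSplittingFieldType F K.
have [alpha _ alphaE] := @finField_galois_generator F L 1%AS {:L}%AS (sub1v _).
by exists (gal_repr alpha : 'End(L)) => x; rewrite alphaE ?memvf // dimv1 expn1.
Qed.

Lemma frobenius_fixed (K : fieldExtType F) (x : K) : (x \in 1%VS) = (x ^+ q == x).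
Proof. by rewrite (@Fermat's_little_theorem F K 1%AS) dimv1 expn1. Qed.

Lemma card_field_eq0 : q%:R = 0 :> F.
Proof.
have [p p_pr pcharF] := finPcharP F.
have [e def_q] : exists e, q = (p ^ e)%N by eexists; apply: (card_pprimeChar pcharF).
have := card_field_gt1 F; rewrite def_q natrX pcharf0 // expr0n.
by case: e {def_q}.
Qed.

(** The roots of X^(q^d) - X in a splitting field are the fixed points of a power
   of the Frobenius automorphism, so they form a field with q^d elements. *)
Lemma exists_field_ext d : (0 < d)%N -> exists K : fieldExtType F, \dim {:K} = d.
Proof.
move=> d_gt0; set m := (q ^ d)%N.
have q_gt1 : (1 < q)%N := card_field_gt1 F.
have m_gt1 : (1 < m)%N by rewrite -(expn0 q) ltn_exp2l.
have nzQ : 'X^m - 'X != 0 :> {poly F}.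
  by rewrite -size_poly_eq0 size_polyDl ?size_polyXn // size_polyN size_polyX.
have [L [zs DQ _]] := FinSplittingFieldFor nzQ.
rewrite rmorphB rmorphXn /= map_polyX in DQ.
have m0 : m%:R = 0 :> L.
  have -> : m%:R = (m%:R : F)%:A :> L by rewrite scaler_nat.
  by rewrite natrX card_field_eq0 expr0n gtn_eqF // scale0r.
have Uzs : uniq zs.
  rewrite -separable_prod_XsubC -(eqp_separable DQ) unlock.
  rewrite derivB derivXn derivX -mulr_natr.
  have -> : m%:R = 0 :> {poly L} by rewrite -polyC1 -rmorphMn /= m0.
  by rewrite mulr0 sub0r -[X in coprimep _ X]scaleN1r coprimepZr ?oppr_eq0 ?oner_eq0 // coprimep1.
have [alpha _ alphaE] := finField_galois_generator (sub1v {:L}%AS).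
pose E := fixedField [set (alpha ^+ d)%g].
have memE z : (z \in E) = (z \in zs).
  rewrite -root_prod_XsubC -(eqp_root DQ) /root !hornerE subr_eq0.
  have alphaX e : (alpha ^+ e)%g z = z ^+ (q ^ e).
    elim: e => [|e IHe]; first by rewrite gal_id expn0.
    by rewrite expgSr galM ?memvf // IHe alphaE ?memvf // dimv1 expn1 expnSr exprM.
  apply/fixedFieldP/eqP => [|fix_z|eq_z x /set1P ->]; first exact: memvf.
    by rewrite -alphaX fix_z ?set11.
  by rewrite alphaX.
exists (subvs_of E : fieldExtType F); rewrite dimvf.
change (\dim E = d).
have : (q ^ \dim E = m)%N.
  have <- := @card_vspace F (finvect_type L) _ (E : {vspace finvect_type L}).
  rewrite (eq_card (B := [in (zs : seq (finvect_type L))])); last exact: memE.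
  rewrite (@card_uniqP (finvect_type L) zs Uzs); apply: succn_inj.
  rewrite -(size_prod_XsubC _ id) -(eqp_size DQ) size_polyDl size_polyXn //.
  by rewrite size_polyN size_polyX.
by move/eqP; rewrite eqn_exp2l // => /eqP.
Qed.

End FieldExtensions.

(** * Spreads from field reduction *)

Section RegularSpreads.
Variables (F : finFieldType) (n k : nat).
Local Notation V := 'rV[F]_n.+1.
Local Notation KS := (kspace F n k).

Lemma linear_bijection (A B : vectType F) : \dim {:A} = \dim {:B} ->
  exists phi : {linear A -> B}, bijective phi.
Proof.
move=> eq_dim; have bA := vbasisP {:A}; have bB := vbasisP {:B}.
have [|f [f' [mapf mapf']]] := linear_of_free_pair (basis_free bA) (basis_free bB).
  by rewrite !size_tuple.
by exists f, f'; [apply: cancel_on_basis bA mapf mapf' | apply: cancel_on_basis bB mapf' mapf].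
Qed.

Section LineSpaces.
Variables (K : fieldExtType F) (t : nat) (phi : {linear V -> {ffun 'I_t -> K}}).
Hypotheses (dimK : \dim {:K} = k.+1) (bij_phi : bijective phi).

(** The spaces of field reduction have the right dimension: a |-> a w is injective
   on K. *)
Lemma line_space (w : {ffun 'I_t -> K}) : w != 0 ->
  exists U : KS, forall v, v \in val U <-> exists a : K, phi v = [ffun j => a * w j].
Proof.
move=> w_neq0; pose g (a : K) : {ffun 'I_t -> K} := [ffun j => a * w j].
have g_lin : linear g.
  by move=> c a b; apply/ffunP => j; rewrite !ffunE mulrDl scalerAl.
pose gL : {linear K -> {ffun 'I_t -> K}} := HB.pack g (GRing.isLinear.Build _ _ _ _ g g_lin).
pose T := limg (linfun gL); pose U := (linfun phi @^-1: T)%VS.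
have memU v : v \in U <-> exists a : K, phi v = g a.
  rewrite -memv_preim lfunE /=; split=> [/memv_imgP[a _ ->] | [a ->]]; first by exists a; rewrite lfunE.
  by apply/memv_imgP; exists a; rewrite ?memvf ?lfunE.
have dimT : \dim T = k.+1.
  rewrite /T limg_dim_eq //; apply/eqP; rewrite -subv0; apply/subvP => a.
  rewrite memv_cap memv_ker lfunE memv0 => /andP[_ /eqP/ffunP g0].
  apply: contraR w_neq0 => a_neq0; apply/eqP/ffunP => j; have /eqP := g0 j.
  by rewrite !ffunE mulf_eq0 (negPf a_neq0) => /eqP.
have dimU : \dim U == k.+1.
  rewrite -dimT -[T in X in _ == X](@lpreimK _ _ _ (linfun phi)).
    rewrite limg_dim_eq //; apply/eqP; rewrite -subv0; apply/subvP => v.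
    rewrite memv_cap memv_ker lfunE memv0 /= => /andP[_ /eqP phi0].
    by apply/eqP; apply: (bij_inj bij_phi); rewrite phi0 linear0.
  apply/subvP => y _; have [psi _ psiK] := bij_phi.
  by apply/memv_imgP; exists (psi y); rewrite ?memvf // lfunE /= psiK.
by exists (Sub U dimU : KS) => v; rewrite SubK; apply: memU.
Qed.

End LineSpaces.

Lemma regular_spread_is_spread (S : {set KS}) : regular_spread S -> spread S.
Proof.
move=> [K [t [phi [dimK _ bij_phi memS]]]]; split.
  move=> U W /memS[w w0 memU] /memS[w' w'0 memW] neqUW.
  rewrite skew_spacesE; apply: contraNT neqUW; rewrite dimv_eq0 => cap_neq0.
  have := memv_pick (val U :&: val W)%VS; set v := vpick _.
  have v_neq0 : v != 0 by rewrite vpick0.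
  rewrite memv_cap => /andP[/memU[a phi_a] /memW[b phi_b]].
  have a_neq0 : a != 0.
    apply: contraNneq v_neq0 => a0; apply/eqP/(bij_inj bij_phi); rewrite linear0 phi_a.
    by apply/ffunP => j; rewrite !ffunE a0 mul0r.
  apply/eqP/kspace_eqP/subvP => y /memU[c phi_c]; apply/memW; exists (c * a^-1 * b).
  rewrite phi_c; apply/ffunP => j; rewrite !ffunE -!mulrA; congr (_ * _).
  move/ffunP/(_ j): phi_b; rewrite phi_a !ffunE => <-.
  by rewrite mulKf.
apply/setP=> p; rewrite in_setT; have [v v0 def_p] := point_spanned p.
have phi0 : phi v != 0.
  by apply: contraNneq v0 => phi0; apply/eqP/(bij_inj bij_phi); rewrite linear0.
have [U memU] := line_space dimK bij_phi phi0.
apply/bigcupP; exists U; first by apply/memS; exists (phi v).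
rewrite mem_points_of def_p -memvE; apply/memU; exists 1.
by apply/ffunP => j; rewrite ffunE mul1r.
Qed.

Lemma gl_set_regular_spread g (S : {set KS}) : regular_spread S -> regular_spread (gl_set g S).
Proof.
move=> [K [t [phi [dimK eq_n bij_phi memS]]]].
exists K, t, (phi \o mulmxr (invmx (GLval g)))%FUN; split=> //.
  apply: bij_comp => //; exists (mulmxr (GLval g)) => v /=; first exact: (mulmxKV (GL_unitmx g)).
  exact: (mulmxK (GL_unitmx g)).
have memg (U : KS) v : (v \in val (gl_kspace g U)) = (v *m invmx (GLval g) \in val U).
  by rewrite -[RHS](mem_gl_space g) (mulmxKV (GL_unitmx g)).
move=> U; split=> [/imsetP[W /memS[w w0 memW] ->] | [w w0 memU]].
  by exists w => // v; rewrite memg; apply: memW.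
apply/imsetP; exists (gl_kspace g^-1%g U); last by rewrite gl_kspaceKV.
apply/memS; exists w => // v.
rewrite -{1}[U](gl_kspaceKV g) in memU; have := memU (v *m GLval g).
by rewrite memg (mulmxK (GL_unitmx g)) /= (mulmxK (GL_unitmx g)).
Qed.

Lemma exists_regular_spread : (k.+1 %| n.+1)%N -> exists S : {set KS}, regular_spread S.
Proof.
move=> /dvdnP[t def_n]; have [K dimK] := exists_field_ext F (ltn0Sn k).
have [phi bij_phi] : exists phi : {linear V -> {ffun 'I_t -> K}}, bijective phi.
  by apply: linear_bijection; rewrite !dimvf /dim /= mul1n card_ord def_n -dimK dimvf.
exists [set U : KS | asbool (exists2 w : {ffun 'I_t -> K}, w != 0 &
  forall v, v \in val U <-> exists a : K, phi v = [ffun j => a * w j])].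
exists K, t, phi; split=> // U; rewrite inE.
by split=> [/asboolP | ?]; last apply/asboolP.
Qed.

End RegularSpreads.

Section SwitchingPair.
Variables (F : finFieldType) (n k : nat).
Local Notation V := 'rV[F]_n.+1.
Local Notation KS := (kspace F n k).
Local Notation PT := (point F n).

Lemma linear_injection (A B : vectType F) : (\dim {:A} <= \dim {:B})%N ->
  exists e : {linear A -> B}, injective e.
Proof.
move=> le_dim; have bA := vbasisP {:A}.
have sz (C : vectType F) : size (vbasis {:C}) = \dim {:C} by apply: size_tuple.
have freeY : free (take (\dim {:A}) (vbasis {:B})).
  apply: (@catl_free _ _ (drop (\dim {:A}) (vbasis {:B}))).
  by rewrite cat_take_drop (basis_free (vbasisP _)).
have [|f [f' [mapf mapf']]] := linear_of_free_pair (basis_free bA) freeY.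
  by rewrite size_takel ?sz.
by exists f; apply: can_inj (cancel_on_basis bA mapf mapf').
Qed.

Variables (K : fieldExtType F) (e : {linear (K * K)%type -> V}).
Hypotheses (dimK : \dim {:K} = k.+1) (inj_e : injective e).
Implicit Types (tau : 'End(K)) (U W : KS).

(** U is the image of the twisted line y = a tau(x) of K^2. *)
Definition is_graph tau (a : K) U : Prop :=
  forall v, v \in val U <-> exists x, v = e (x, a * tau x).

Definition graph_set tau : {set KS} :=
  [set U | asbool (exists2 a : K, a != 0 & is_graph tau a U)].

Lemma graph_setP tau U :
  U \in graph_set tau <-> exists2 a : K, a != 0 & is_graph tau a U.
Proof. by rewrite inE; split=> [/asboolP | ?]; last apply/asboolP. Qed.

Lemma e_eq0 x y : e (x, y) = 0 -> x = 0 /\ y = 0.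
Proof. by rewrite -(linear0 e) => /inj_e[]. Qed.

Lemma is_graph_exists tau a : exists U, is_graph tau a U.
Proof.
pose g (x : K) : V := e (x, a * tau x).
have g_lin : linear g.
  move=> c x y; rewrite /g -linearP; apply: (congr1 e); apply: (congr2 pair) => //=.
  by rewrite linearP mulrDr -scalerAr.
pose gL : {linear K -> V} := HB.pack g (GRing.isLinear.Build _ _ _ _ g g_lin).
have dimG : \dim (limg (linfun gL)) == k.+1.
  rewrite -dimK limg_dim_eq //; apply/eqP; rewrite -subv0; apply/subvP => x.
  by rewrite memv_cap memv_ker lfunE memv0 /= => /andP[_ /eqP/e_eq0[-> _]].
exists (Sub (limg (linfun gL)) dimG : KS) => v; rewrite SubK.
split=> [/memv_imgP[x _ ->] | [x ->]]; first by exists x; rewrite lfunE.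
by apply/memv_imgP; exists x; rewrite ?memvf ?lfunE.
Qed.

Section Injective.
Variable tau : 'End(K).
Hypothesis inj_tau : forall x, tau x = 0 -> x = 0.

Lemma graph_set_partial_spread : partial_spread (graph_set tau).
Proof.
move=> U W /graph_setP[a a0 memU] /graph_setP[b b0 memW] neqUW.
rewrite skew_spacesE; apply: contraNT neqUW; rewrite dimv_eq0 => cap_neq0.
have := memv_pick (val U :&: val W)%VS; rewrite memv_cap.
case/andP => /memU[x def_x] /memW[y def_y].
have v0 : e (x, a * tau x) != 0 by rewrite -def_x vpick0.
have x0 : tau x != 0.
  by apply: contraNneq v0 => /[dup] /inj_tau -> ->; rewrite mulr0 linear0.
have [eq_xy] : (x, a * tau x) = (y, b * tau y) by apply: inj_e; rewrite -def_x.
rewrite -eq_xy => /(mulIf x0) eq_ab; apply/eqP/kspace_eqP/subvP => v.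
by rewrite -eq_ab in memW; move=> /memU ?; apply/memW.
Qed.

(** For given x and y off the axes, a = y / tau(x) is the unique slope, whatever
   tau is. *)
Lemma cover_graph_set (p : PT) : (p \in cover_of (graph_set tau)) <->
  exists x y, [/\ x != 0, y != 0 & val p = <[e (x, y)]>%VS].
Proof.
split=> [/bigcupP[U /graph_setP[a a0 memU]] | [x [y [x0 y0 def_p]]]].
  rewrite mem_points_of; have [v v0 def_p] := point_spanned p.
  rewrite def_p -memvE => /memU[x def_v].
  have x0 : x != 0.
    by apply: contraNneq v0 => x0; rewrite def_v x0 linear0 mulr0 linear0.
  exists x, (a * tau x); split; rewrite ?def_v ?mulf_eq0 ?negb_or ?a0 //.
  by apply: contraNneq x0 => /inj_tau ->.
have tx0 : tau x != 0 by apply: contraNneq x0 => /inj_tau ->.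
have [U memU] := is_graph_exists tau (y / tau x).
apply/bigcupP; exists U.
  by apply/graph_setP; exists (y / tau x); rewrite ?mulf_neq0 ?invr_eq0.
by rewrite mem_points_of def_p -memvE; apply/memU; exists x; rewrite divfK.
Qed.

End Injective.

End SwitchingPair.

(** In K^2, the lines y = a x and the twisted lines y = a x^q, a <> 0, cover the
   same points, those off the axes.  The line y = x meets y = a x^q in at most a
   point, as two solutions of x = a x^q differ by a factor fixed by Frobenius. *)
Lemma exists_switching_pair (F : finFieldType) (n k : nat) :
    (2 * k + 1 <= n)%N -> (0 < k)%N ->
  exists (S T : {set kspace F n k}) (U0 : kspace F n k),
    [/\ conjugate_switching_sets S T, U0 \in S
      & forall W, W \in T -> (\dim (val U0 :&: val W) <= 1)%N].
Proof.
move=> le_n k_gt0; have [K dimK] := exists_field_ext F (ltn0Sn k).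
have [|e inj_e] := @linear_injection F (K * K)%type 'rV[F]_n.+1.
  by rewrite !dimvf [dim (K * K)%type]/dim /= [dim 'rV_ _]/dim /= -!dimvf dimK mul1n; lia.
have [tau tauE] := frobenius_linear K.
have inj_tau x : tau x = 0 -> x = 0.
  by rewrite tauE => /eqP; rewrite expf_eq0 => /andP[_ /eqP].
have inj_id x : (\1%VF : 'End(K)) x = 0 -> x = 0 by rewrite id_lfunE.
have [U0 memU0] := is_graph_exists dimK inj_e \1%VF 1.
exists (graph_set k e \1%VF), (graph_set k e tau), U0; split.
- split; try exact: graph_set_partial_spread.
    apply/setP=> U; rewrite in_set0 inE; apply/negP => /andP[].
    move=> /graph_setP[a a0 memU] /graph_setP[b b0 memU'].
    have graphs x : a * x = b * x ^+ #|F|.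
      have /memU'[y /inj_e[<-]] : e (x, a * (\1%VF : 'End(K)) x) \in val U.
        by apply/memU; exists x.
      by rewrite id_lfunE tauE.
    have eq_ab : a = b by have := graphs 1; rewrite expr1n !mulr1.
    have : (\dim {:K} <= \dim (1%VS : {vspace K}))%N.
      apply: dimvS; apply/subvP => x _; rewrite frobenius_fixed.
      by have := graphs x; rewrite -eq_ab => /(mulfI a0) <-.
    by rewrite dimK dimv1; lia.
  by apply/setP=> p; apply/idP/idP => /cover_graph_set cov; apply/cover_graph_set => //; apply: cov.
- by apply/graph_setP; exists 1; rewrite ?oner_neq0.
move=> W /graph_setP[b b0 memW].
have [cap0 | cap_neq0] := eqVneq (val U0 :&: val W)%VS 0%VS; first by rewrite cap0 dimv0.
have capE v : v \in (val U0 :&: val W)%VS -> exists2 x, v = e (x, x) & x = b * x ^+ #|F|.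
  rewrite memv_cap => /andP[/memU0[x ->] /memW[y /inj_e[<-]]].
  by rewrite id_lfunE mul1r tauE => eq_x; exists x.
have [x0 def_x0 eq_x0] := capE _ (memv_pick _).
have x0_neq0 : x0 != 0.
  by apply: contraNneq cap_neq0 => x00; rewrite -vpick0 def_x0 x00 linear0.
have : (val U0 :&: val W <= <[e (x0, x0)]>)%VS.
  apply/subvP => v /capE[x -> eq_x].
  have /vlineP[c def_c] : x / x0 \in 1%VS.
    rewrite frobenius_fixed expr_div_n [in X in _ == X]eq_x [in X in _ == X]eq_x0.
    by rewrite -mulf_div divff ?mul1r.
  apply/vlineP; exists c; rewrite -linearZ; congr (e _).
  have -> : x = c *: x0 by rewrite -mulr_algl -def_c divfK.
  by [].
by move=> /dimvS/leq_trans-> //; rewrite dim_vline; case: (_ != 0).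
Qed.

(** * The equivalences *)

Section Characterisations.
Variables (R : realType) (F : finFieldType) (k n : nat).
Hypothesis le_n : (2 * k + 1 <= n)%N.
Local Notation KS := (kspace F n k).
Local Notation PT := (point F n).
Local Notation q := (#|F|%:R : R).
Local Notation P := (grass_eigenvalue q n k).
Local Notation A := (incidence_mx R F n k).
Implicit Types (f : KS -> R) (U W : KS).

Let q_not_root := natr_base_not_root R (card_field_gt1 F).

Lemma grass_eigenvalue_i0 j : (j <= k.+1)%N -> P j 0 = 1.
Proof.
move=> le_j; rewrite /grass_eigenvalue max0n !subn0 (minn_idPl le_j) big_nat1.
rewrite addnn -signr_odd odd_double gaussnn // addnK gaussnn // gauss_n0 mul0n subnn bin_small //.
by ring.
Qed.

Lemma grass_op0 f U : grass_op 0 f U = f U.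
Proof.
rewrite /grass_op (big_pred1 U) // => W; rewrite /grass_rel subn0.
apply/eqP/eqP => [dimUW | ->]; last by rewrite capvv dim_kspace.
apply/esym/kspace_eqP; apply/capv_idPl/eqP.
by rewrite eqEdim capvSl dimUW dim_kspace leqnn.
Qed.

(** An operator A_i of the scheme whose P_ji, j >= 2, avoid b detects membership
   in the image through an affine relation of slope b. *)
Lemma in_im_affine i b c f : (i <= k.+1)%N ->
    (forall j, (2 <= j <= k.+1)%N -> P j i != b) ->
  (forall U, grass_op i f U = b * f U + c) -> in_im f.
Proof.
move=> le_i neq_b affine.
apply: (@in_im_criterion F R n k le_n [:: (1, i); (- b, 0%N)]); first by rewrite /scheme_index /= le_i.
  move=> j le_j; rewrite /scheme_eigenvalue !big_cons big_nil /=.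
  rewrite grass_eigenvalue_i0 ?mulr1 ?mul1r ?addr0 ?subr_eq0 ?neq_b //.
  by case/andP: le_j.
apply: eq_in_im (@in_im_cst F R n k c) => U.
by rewrite /scheme_op !big_cons big_nil /= grass_op0 affine; ring.
Qed.

Lemma grass_op_cst i c U : (i <= k.+1)%N -> grass_op i (fun=> c) U = P 0 i * c.
Proof.
move=> le_i; rewrite /grass_op sumr_const -[LHS]mulr_natl -(card_grass_rel le_n R U le_i).
by congr (_%:R * _); apply: eq_card => W; rewrite inE.
Qed.

Lemma gauss1 m : gauss q m 1 = (q ^+ m - 1) / (q - 1).
Proof. by rewrite gaussS gauss_n0 subn0 mulr1. Qed.

Lemma card_all_points : #|{: PT}|%:R = gauss q n.+1 1.
Proof.
have := card_points_sub R (fullv : {vspace 'rV[F]_n.+1}).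
rewrite dimvf /dim /= mul1n => <-; congr _%:R.
by apply: eq_card => p; rewrite !inE subvf.
Qed.

(** Applying A_i to the all-one function, seen as a constant function on points,
   compares its eigenvalue with the one on the sum-zero part of the image. *)
Lemma through_num_eigenvalues i U : (i <= k.+1)%N ->
  through_num F R n k i 1 0
  = (P 0 i - P 1 i) * ((q ^+ k.+1 - 1) / (q ^+ n.+1 - 1)).
Proof.
move=> le_i; pose u1 := (fun=> 1) : PT -> R.
have := grass_op_point_sum le_n u1 U le_i.
have sum1 (W : KS) : point_sum u1 W = gauss q k.+1 1.
  have := card_points_sub R (val W); rewrite dim_kspace => <-.
  by rewrite /point_sum sumr_const; congr _%:R; apply: eq_card => p; rewrite inE.
rewrite (eq_grass_op _ _ sum1) grass_op_cst // sum1 sumr_const card_all_points !gauss1.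
have nz1 := q_not_root (ltn0Sn 0); have nzn := q_not_root (ltn0Sn n).
rewrite expr1 in nz1; set m := through_num _ _ _ _ _ _ _.
set a := q ^+ k.+1 - 1; set b := q ^+ n.+1 - 1; set c := q - 1 => eq_m.
have -> : m = (P 1 i * (a / c) + m * (b / c) - P 1 i * (a / c)) * (c / b).
  by rewrite /c in nz1 *; field; rewrite nz1 nzn.
by rewrite -eq_m; field; rewrite nz1 nzn.
Qed.

Variables (L : {set KS}) (X : R).
Hypothesis card_L : #|L|%:R = X * gauss q n k.
Local Notation chi := (fun U : KS => (U \in L)%:R : R).

Lemma sum_chi : \sum_U chi U = #|L|%:R.
Proof. by rewrite -sum1_card natr_sum [RHS]big_mkcond; apply: eq_bigr => U _; case: ifP. Qed.

Lemma card_rel i U : #|[set W in L | grass_rel i U W]|%:R = grass_op i chi U.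
Proof.
rewrite /grass_op -sum1_card natr_sum big_mkcond [RHS]big_mkcond; apply: eq_bigr => W _.
by rewrite inE; case: (W \in L); case: (grass_rel i U W).
Qed.

Lemma point_sum_total u : (forall U, chi U = point_sum u U) -> \sum_p u p = X.
Proof.
move=> def_chi; have nz : gauss q n k != 0.
  by rewrite gt_eqF // gauss_gt0; lia.
apply: (mulfI nz); rewrite -sum_point_sum -(eq_bigr _ (fun U _ => def_chi U)).
by rewrite sum_chi card_L mulrC.
Qed.

(** For i >= 1, the affine relation between A_i chi and chi that holds for point
   sums characterises them, because P_1i differs from the P_ji with j >= 2. *)
Lemma in_im_rel i : (1 <= i <= k.+1)%N ->
  in_im chi <-> forall U, #|[set W in L | grass_rel i U W]|%:R
                            = P 1 i * chi U + through_num F R n k i 1 0 * X.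
Proof.
move=> /andP[i_gt0 le_i]; split=> [[u def_chi] U | rel].
  by rewrite card_rel (eq_grass_op _ _ def_chi) grass_op_point_sum // -def_chi (point_sum_total def_chi).
apply: (@in_im_affine i (P 1 i) (through_num F R n k i 1 0 * X) chi le_i) => [j le_j|U].
  by apply: grass_eigenvalue_neq1; rewrite ?card_field_gt1 ?i_gt0.
by rewrite -card_rel rel.
Qed.

Lemma through_num_10 i : (1 <= i <= k.+1)%N ->
  through_num F R n k i 1 0 = gauss q (n - k - 1) (i - 1) * gauss q k.+1 i * q ^+ (i * (i - 1)).
Proof.
move=> lt_i; rewrite /through_num ifT ?addn0 ?subn0; last by lia.
have -> : (n - k - 1 = (i - 1) + (n - k - i))%N by lia.
by rewrite (gauss_sym q_not_root); ring.
Qed.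

Lemma through_num_11 i : (1 <= i <= k.+1)%N ->
  through_num F R n k i 1 1
  = q ^+ i * ((q ^+ (n - k) - 1) / (q ^+ i - 1)) * gauss q k i
    * q ^+ (i * (i - 1)) * gauss q (n - k - 1) (i - 1).
Proof.
move=> lt_i; rewrite /through_num ifT; last by lia.
rewrite addnK addnK subSS subn0.
have -> : gauss q (n - k) (n - k - i) = gauss q (n - k) i.
  have -> : (n - k = i + (n - k - i))%N by lia.
  by rewrite addKn (gauss_sym q_not_root).
have -> : gauss q (n - k) i = (q ^+ (n - k) - 1) / (q ^+ i - 1) * gauss q (n - k - 1) (i - 1).
  have -> : (n - k = (n - k - 1).+1)%N by lia.
  by case: i lt_i => // i _; rewrite gaussSS !subSS !subn0.
have -> : (i * i = i + i * (i - 1))%N by nia.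
by rewrite exprD; ring.
Qed.

Lemma gauss_quotE i : (i <= k.+1)%N -> gauss_quot q k i = gauss q k.+1 i.
Proof.
move=> le_i; rewrite /gauss_quot; case: eqP => [// | neq_i].
have -> : gauss q k i = gauss q (i + (k - i)) i by congr gauss; lia.
have -> : gauss q k.+1 i = gauss q (i + (k - i).+1) i by congr gauss; lia.
rewrite !(gauss_sym q_not_root) addnS gaussSS.
by congr ((q ^+ _ - 1) / _ * _); lia.
Qed.

Lemma in_im_grassP i : (1 <= i <= k.+1)%N ->
  in_im chi <-> forall U, #|[set W in L | grass_rel i U W]|%:R
    = if U \in L then
        ((X - 1) * gauss_quot q k i
         + q ^+ i * ((q ^+ (n - k) - 1) / (q ^+ i - 1)) * gauss q k i)
        * q ^+ (i * (i - 1)) * gauss q (n - k - 1) (i - 1)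
      else X * gauss q (n - k - 1) (i - 1) * gauss q k.+1 i * q ^+ (i * (i - 1)).
Proof.
move=> lt_i; have /andP[i_gt0 le_i] := lt_i; apply: iff_trans (in_im_rel lt_i) _.
suff val U : P 1 i * chi U + through_num F R n k i 1 0 * X
    = if U \in L then
        ((X - 1) * gauss_quot q k i
         + q ^+ i * ((q ^+ (n - k) - 1) / (q ^+ i - 1)) * gauss q k i)
        * q ^+ (i * (i - 1)) * gauss q (n - k - 1) (i - 1)
      else X * gauss q (n - k - 1) (i - 1) * gauss q k.+1 i * q ^+ (i * (i - 1)).
  by split=> rel U; rewrite rel val.
rewrite grass_eigenvalue1 // through_num_11 // through_num_10 // gauss_quotE //.
by case: (U \in L); rewrite /=; ring.
Qed.

Lemma in_im_skewP :
  in_im chi <-> forall U, #|[set W in L | skew_spaces U W]|%:R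
    = (X - chi U) * gauss q (n - k - 1) k * q ^+ (k ^ 2 + k).
Proof.
have lt_k : (1 <= k.+1 <= k.+1)%N by rewrite leqnn.
apply: iff_trans (in_im_rel lt_k) _.
have val U : P 1 k.+1 * chi U + through_num F R n k k.+1 1 0 * X
    = (X - chi U) * gauss q (n - k - 1) k * q ^+ (k ^ 2 + k).
  rewrite grass_eigenvalue1 // through_num_11 // through_num_10 // subn1 /= gaussnn //.
  rewrite (@gauss_small _ _ k k.+1) // (_ : (k.+1 * k = k ^ 2 + k)%N); last by lia.
  by ring.
have skewE U : [set W in L | skew_spaces U W] = [set W in L | grass_rel k.+1 U W].
  by apply/setP=> W; rewrite !inE skew_grass_rel.
by split=> rel U; have := rel U; rewrite skewE val.
Qed.

Local Notation V := (grass_eigenspace R F n k).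
Local Notation chiv := (char_vec R L).

Lemma char_vecE U : chiv (enum_rank U) 0 = chi U.
Proof. by rewrite mxE enum_rankK. Qed.

Lemma in_im_limg (x : 'cV[R]_#|{: KS}|) :
  in_im (fun U => x (enum_rank U) 0) <-> x \in limg (linfun (mulmx A^T : 'cV_ _ -> 'cV_ _)).
Proof.
apply: iff_trans (in_imP x) _.
split=> [[y ->] | /memv_imgP[y _ ->]]; last by exists y; rewrite lfunE.
by apply/memv_imgP; exists y; rewrite ?memvf ?lfunE.
Qed.

Lemma in_im_limgP : in_im chi <-> chiv \in limg (linfun (mulmx A^T : 'cV_ _ -> 'cV_ _)).
Proof.
apply: iff_trans (in_im_limg chiv).
by split; apply: eq_in_im => U; rewrite char_vecE.
Qed.

Lemma in_im_orthP :
  in_im chi <-> in_orth (lker (linfun (mulmx A : 'cV_ _ -> 'cV_ _))) chiv.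
Proof.
have memker (v : 'cV[R]_#|{: KS}|) :
    (v \in lker (linfun (mulmx A : 'cV_ _ -> 'cV_ _))) = (A *m v == 0).
  by rewrite memv_ker lfunE.
apply: iff_trans in_im_limgP _; split=> [/memv_imgP[y _ ->] v | orth].
  rewrite memker lfunE /= => /eqP Av0.
  by rewrite trmx_mul trmxK -mulmxA Av0 mulmx0 mxE.
have [y ker_z] := im_ker_decomposition A chiv; set z := chiv - A^T *m y in ker_z.
suff z0 : z = 0.
  apply/memv_imgP; exists y; rewrite ?memvf // lfunE /=.
  by apply/eqP; rewrite -subr_eq0 -/z z0.
apply: gram_eq0; apply/matrixP => i j; rewrite !ord1 [RHS]mxE.
have -> : z^T = chiv^T - y^T *m A by rewrite /z linearB /= trmx_mul trmxK.
rewrite mulmxBl -mulmxA ker_z mulmx0 subr0.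
by apply: orth; rewrite memker ker_z.
Qed.

Lemma mem_grass_eigenspace j (x : 'cV[R]_#|{: KS}|) :
  (x \in V j) <-> (forall i, (i <= k.+1)%N -> forall U,
    grass_op i (fun W => x (enum_rank W) 0) U = P j i * x (enum_rank U) 0).
Proof.
have mem_i i : (x \in passmx.leigenspace (linfun (mulmx (grass_adj R F n k i))) (P j i))
    <-> (forall U, grass_op i (fun W => x (enum_rank W) 0) U = P j i * x (enum_rank U) 0).
  rewrite memv_ker add_lfunE opp_lfunE scale_lfunE id_lfunE lfunE /= subr_eq0.
  split=> [/eqP eigen U | eigen].
    by rewrite -{1}(enum_rankK U) -grass_adjE eigen mxE.
  by apply/eqP/colP => l; rewrite grass_adjE eigen enum_valK mxE.
split=> [/subv_bigcapP xV i le_i | eigen].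
  by apply/mem_i; rewrite memvE; apply: (xV (Ordinal (le_i : (i < k.+2)%N))).
by apply/subv_bigcapP => i _; rewrite -memvE; apply/mem_i/eigen; rewrite -ltnS.
Qed.

(** The eigenvalue of the disjointness operator A_(k+1) suffices to recognise
   V_0 and V_1. *)
Lemma in_im_eigenvector j (x : 'cV[R]_#|{: KS}|) : (j <= 1)%N -> x \in V j ->
  in_im (fun U => x (enum_rank U) 0).
Proof.
move=> le_j /mem_grass_eigenspace/(_ _ (leqnn _)) eigen.
apply: (@in_im_affine k.+1 (P j k.+1) 0) => [//|j' /andP[j'_gt1 le_j'] | U]; last first.
  by rewrite eigen addr0.
by apply: grass_eigenvalue_neq; rewrite ?card_field_gt1 // (minn_idPr le_j'); lia.
Qed.

Local Notation mean := (X * ((q ^+ k.+1 - 1) / (q ^+ n.+1 - 1))).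

Lemma in_im_V1 : in_im chi -> chiv - mean *: all_one R F n k \in V 1.
Proof.
move=> [u def_chi]; apply/mem_grass_eigenspace => i le_i U.
set m := mean; have vecE W : (chiv - m *: all_one R F n k) (enum_rank W) 0 = chi W - m.
  by rewrite !mxE enum_rankK; ring.
rewrite vecE (eq_grass_op _ _ vecE).
have -> : grass_op i (fun W => chi W - m) U = grass_op i chi U + grass_op i (fun=> - m) U.
  by rewrite -big_split.
rewrite grass_op_cst //.
rewrite (eq_grass_op _ _ def_chi) grass_op_point_sum // -def_chi (point_sum_total def_chi).
by rewrite (through_num_eigenvalues U le_i) /m; ring.
Qed.

Lemma all_one_V0 : all_one R F n k \in V 0.
Proof.
apply/mem_grass_eigenspace => i le_i U; rewrite mxE.
rewrite (@eq_grass_op _ _ _ _ _ _ (fun=> 1)) ?grass_op_cst // => W.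
by rewrite mxE.
Qed.

Lemma in_im_V0V1 : chiv \in (V 0 + V 1)%VS -> in_im chi.
Proof.
case/memv_addP => v0 V0v0 [v1 V1v1 def_chi].
have := in_imD (in_im_eigenvector (leq0n 1) V0v0) (in_im_eigenvector (leqnn 1) V1v1).
by apply: eq_in_im => U; rewrite -char_vecE def_chi mxE.
Qed.

Lemma partial_spread_inter S u : (forall U, chi U = point_sum u U) -> partial_spread S ->
  #|L :&: S|%:R = \sum_(p in cover_of S) u p.
Proof.
move=> def_chi spS; rewrite card_inter_sum -sum_cover //; apply: eq_bigr => U _.
by rewrite def_chi; apply: eq_bigl => p; rewrite inE.
Qed.

Lemma in_im_switching : in_im chi -> forall S T : {set KS},
  conjugate_switching_sets S T -> #|L :&: S| = #|L :&: T|.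
Proof.
move=> [u def_chi] S T [spS spT _ eq_cov]; apply/eqP; rewrite -(eqr_nat R).
by rewrite !(partial_spread_inter def_chi) // eq_cov.
Qed.

Lemma in_im_spread : in_im chi -> forall S : {set KS}, spread S -> #|L :&: S|%:R = X.
Proof.
move=> [u def_chi] S [spS covS]; rewrite (partial_spread_inter def_chi) // covS.
rewrite -(point_sum_total def_chi); apply: eq_bigl => p.
by rewrite inE.
Qed.

Lemma meet_index_self U : meet_index U U = 0%N.
Proof. by rewrite /meet_index capvv dim_kspace subnn. Qed.

(** Averaging over the stabiliser of an element U0 of a partial spread counts U0
   once, and every other element as a random space disjoint from U0. *)
Lemma average_partial_spread (S : {set KS}) U0 f U : partial_spread S -> U0 \in S ->
  \sum_(W in S) grass_op (meet_index U0 W) f U / P 0 (meet_index U0 W)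
  = f U + (#|S|%:R - 1) * (grass_op k.+1 f U / P 0 k.+1).
Proof.
move=> spS SU0; rewrite (bigD1 U0) //= meet_index_self grass_op0 grass_eigenvalue_i0 // divr1.
congr (_ + _); rewrite (eq_bigr (fun=> grass_op k.+1 f U / P 0 k.+1)) => [|W /andP[SW neqW]].
  rewrite (eq_bigl [in S :\ U0]) => [|W]; last by rewrite !inE andbC.
  by rewrite sumr_const [#|S|](cardsD1 U0) SU0 -[LHS]mulr_natl add1n mulrSr addrK.
have := spS _ _ SU0 SW; rewrite eq_sym neqW skew_spacesE => /(_ isT)/eqP dim0.
by rewrite /meet_index dim0 subn0.
Qed.

(** A spread forces k+1 to divide n+1, so that field reduction applies. *)
Lemma regular_spread_in_im : (exists S : {set KS}, spread S) ->
  (forall S : {set KS}, regular_spread S -> #|L :&: S|%:R = X) -> in_im chi.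
Proof.
move=> [S0 spS0] meet_X.
have dvd_n : (k.+1 %| n.+1)%N.
  apply: (dvdn_of_predX (card_field_gt1 F)) => //.
  by rewrite -(card_spread R spS0) dvdn_mull.
have [S regS] := exists_regular_spread F dvd_n.
have spS := regular_spread_is_spread regS; have [pspS _] := spS.
have card_S := card_spread R spS.
have [U0 SU0] : exists U0, U0 \in S.
  apply/set0Pn; apply: contra_eq_neq card_S => ->; rewrite cards0 mul0n eq_sym -lt0n.
  by rewrite subn_gt0 -{1}(expn0 #|F|) ltn_exp2l ?card_field_gt1.
pose c := [:: (1, 0%N); ((#|S|%:R - 1) / P 0 k.+1, k.+1)] : seq (R * nat).
apply: (@in_im_criterion F R n k le_n c); first by rewrite /scheme_index /= leqnn.
  move=> j le_j; rewrite /scheme_eigenvalue !big_cons big_nil /= addr0.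
  rewrite grass_eigenvalue_i0 ?mul1r; last by case/andP: le_j.
  by apply: spread_eigenvalue_neq0; rewrite ?card_field_gt1.
apply: eq_in_im (@in_im_cst F R n k X) => U.
rewrite /scheme_op !big_cons big_nil /= addr0 mul1r grass_op0 mulrAC -mulrA.
have := average_set le_n chi S U0 U; rewrite (average_partial_spread _ _ pspS SU0).
rewrite (eq_bigr (fun=> X)) => [|g _]; last first.
  by rewrite -(sum_gl_set g S chi) -card_inter_sum meet_X //; apply: gl_set_regular_spread.
have : #|[set g | gl_kspace g U0 == U]|%:R != 0 :> R.
  by rewrite pnatr_eq0 -lt0n card_stabiliser_gt0.
rewrite (eq_bigl [in [set g | gl_kspace g U0 == U]]) => [|g]; last by rewrite inE.
rewrite sumr_const -[X *+ _]mulr_natl; move: #|_| => a a0 /(mulfI a0) ->.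
by [].
Qed.

(** For k = 0 every function is a point sum; otherwise the averaged switching
   equation has no solution in the kernel. *)
Lemma switching_in_im : (forall S T : {set KS},
  conjugate_switching_sets S T -> #|L :&: S| = #|L :&: T|) -> in_im chi.
Proof.
move=> switch; have [k0 | k_gt0] := posnP k.
  apply: (@in_im_criterion F R n k le_n [::]) => // [j|]; first by rewrite k0; lia.
  by apply: eq_in_im (@in_im_cst F R n k 0) => U; rewrite /scheme_op big_nil.
have [S [T [U0 [swST SU0 dim_le1]]]] := exists_switching_pair F le_n k_gt0.
have [spS spT _ eq_cov] := swST.
pose r := #|[set W in T | \dim (val U0 :&: val W) == 1%N]|.
have g1 : gauss q k.+1 1 != 0 by rewrite gt_eqF ?gauss_gt0.
have card_ST : #|T|%:R = #|S|%:R :> R.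
  by apply: (mulIf g1); rewrite -!(card_cover R) // eq_cov.
(* The points of U0 are covered by T, each once, and each W in T has at most
   one of them. *)
have r_points : r%:R = gauss q k.+1 1.
  transitivity (\sum_(W in T) gauss q (\dim (val U0 :&: val W)) 1).
    rewrite /r -sum1_card natr_sum big_mkcond [RHS]big_mkcond; apply: eq_bigr => W _.
    rewrite inE; case TW: (W \in T) => //=; have := dim_le1 W TW.
    by case: (\dim _) => [|[|//]] _; rewrite /= ?gaussnn ?gauss_small.
  transitivity (\sum_(W in T) \sum_(p in points_of W) (p \in points_of U0)%:R : R).
    apply: eq_bigr => W _; rewrite -card_points_sub -sum1_card natr_sum.
    rewrite big_mkcond [RHS]big_mkcond; apply: eq_bigr => p _.
    by rewrite !inE subv_cap; case: (_ <= val W)%VS; case: (_ <= val U0)%VS.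
  rewrite sum_cover // -eq_cov -(card_points R U0) -sum1_card natr_sum.
  rewrite big_mkcond [RHS]big_mkcond; apply: eq_bigr => p _.
  case U0p: (p \in points_of U0); last by case: ifP.
  by rewrite ifT //; apply/bigcupP; exists U0.
have card_r : (r * (#|F| - 1) = #|F| ^ k.+1 - 1)%N.
  have gt0 e : (0 < #|F| ^ e)%N by rewrite expn_gt0 ltnW ?card_field_gt1.
  apply/eqP; rewrite -(eqr_nat R) natrM r_points gauss1.
  rewrite !natrB ?gt0 ?(ltnW (card_field_gt1 F)) // natrX divfK //.
  exact: (q_not_root (ltn0Sn 0)).
pose c := [:: (1, 0%N); ((r%:R - 1) / P 0 k.+1, k.+1); (- (r%:R / P 0 k), k)] : seq (R * nat).
apply: (@in_im_criterion F R n k le_n c); first by rewrite /scheme_index /= leqnn leqnSn.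
  move=> j le_j; rewrite /scheme_eigenvalue !big_cons big_nil /= addr0 addrA mulNr.
  rewrite grass_eigenvalue_i0 ?mul1r; last by case/andP: le_j.
  by apply: switching_eigenvalue_neq0; rewrite ?card_field_gt1.
apply: eq_in_im (@in_im_cst F R n k 0) => U.
rewrite /scheme_op !big_cons big_nil /= addr0 mul1r grass_op0.
have a0 : #|[set g | gl_kspace g U0 == U]|%:R != 0 :> R.
  by rewrite pnatr_eq0 -lt0n card_stabiliser_gt0.
have avS := average_set le_n chi S U0 U; have avT := average_set le_n chi T U0 U.
have : \sum_(W in S) grass_op (meet_index U0 W) chi U / P 0 (meet_index U0 W)
     = \sum_(W in T) grass_op (meet_index U0 W) chi U / P 0 (meet_index U0 W).
  apply: (mulfI a0); rewrite -avS -avT; apply: eq_bigr => g _.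
  rewrite -!(sum_gl_set g _ chi) -!card_inter_sum.
  by rewrite (switch _ _ (gl_set_switching g swST)).
rewrite (average_partial_spread _ _ spS SU0).
have -> : \sum_(W in T) grass_op (meet_index U0 W) chi U / P 0 (meet_index U0 W)
    = r%:R * (grass_op k chi U / P 0 k)
      + (#|T|%:R - r%:R) * (grass_op k.+1 chi U / P 0 k.+1).
  rewrite (bigID (fun W => \dim (val U0 :&: val W) == 1%N)) /=; congr (_ + _).
    rewrite (eq_bigr (fun=> grass_op k chi U / P 0 k)) => [|W /andP[_ /eqP dim1]]; last first.
      by rewrite /meet_index dim1 subSS subn0.
    rewrite sumr_const -[LHS]mulr_natl; congr (_%:R * _).
    by apply: eq_card => W; rewrite inE.
  rewrite (eq_bigr (fun=> grass_op k.+1 chi U / P 0 k.+1)) => [|W /andP[TW dim_neq1]]; last first.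
    have := dim_le1 W TW; rewrite leq_eqVlt (negPf dim_neq1) ltnS leqn0 => /eqP dim0.
    by rewrite /meet_index dim0 subn0.
  rewrite sumr_const -[LHS]mulr_natl; congr (_ * _).
  rewrite -(cardsID [set W | \dim (val U0 :&: val W) == 1%N] T) natrD.
  have -> : T :&: [set W | \dim (val U0 :&: val W) == 1%N]
      = [set W in T | \dim (val U0 :&: val W) == 1%N] by apply/setP=> W; rewrite !inE.
  rewrite -/r addrC addKr; congr _%:R.
  by apply: eq_card => W; rewrite !inE andbC.
rewrite card_ST => eq0; apply/esym.
set a := grass_op k.+1 chi U / P 0 k.+1 in eq0; set b := grass_op k chi U / P 0 k in eq0.
have -> : (r%:R - 1) / P 0 k.+1 * grass_op k.+1 chi U = (r%:R - 1) * a.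
  by rewrite /a mulrAC mulrA.
have -> : - (r%:R / P 0 k) * grass_op k chi U = - (r%:R * b).
  by rewrite /b mulNr mulrAC mulrA.
by move/eqP: eq0; rewrite -subr_eq0 => /eqP eq0; rewrite -[RHS]eq0; ring.
Qed.

End Characterisations.

Lemma ratr_gauss (R : realType) (m a b : nat) :
  ratr (gauss (m%:R : rat) a b) = gauss (m%:R : R) a b.
Proof.
rewrite /gauss rmorph_prod; apply: eq_bigr => i _.
by rewrite fmorph_div !rmorphB !rmorphXn /= ratr_nat rmorph1.
Qed.

Lemma ratr_gauss_quot (R : realType) (m k i : nat) :
  ratr (gauss_quot (m%:R : rat) k i) = gauss_quot (m%:R : R) k i.
Proof.
rewrite /gauss_quot; case: ifP => _; rewrite ?ratr_gauss //.
by rewrite rmorphM fmorph_div !rmorphB !rmorphXn /= ratr_nat rmorph1 ratr_gauss.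
Qed.

Theorem theorem2p9 (R : realType) (F : finFieldType) (k n : nat)
    (hn : (2 * k + 1 <= n)%N)
    (L : {set kspace F n k}) (hL : L != set0)
    (x : rat) (hx : #|L|%:R = x * gauss (#|F|%:R : rat) n k)
    (i : nat) (hi : (1 <= i <= k.+1)%N) :
  let q : rat := #|F|%:R in
  let qR : R := #|F|%:R in
  let A := incidence_mx R F n k in
  let chi := char_vec R L in
  let V := grass_eigenspace R F n k in
  [<-> (* 1 *) chi \in limg (linfun (mulmx A^T : 'cV_ _ -> 'cV_ _));
       (* 2 *) in_orth (lker (linfun (mulmx A : 'cV_ _ -> 'cV_ _))) chi;
       (* 3 *) forall U : kspace F n k,
         #|[set W in L | skew_spaces U W]|%:R
         = (x - (U \in L)%:R) * gauss q (n - k - 1) k * q ^+ (k ^ 2 + k);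
       (* 4 *) chi - (ratr x * ((qR ^+ k.+1 - 1) / (qR ^+ n.+1 - 1)))
                     *: all_one R F n k \in V 1%N;
       (* 5 *) chi \in (V 0%N + V 1%N)%VS;
       (* 6 *) forall U : kspace F n k,
         #|[set W in L | grass_rel i U W]|%:R
         = if U \in L then
             ((x - 1) * gauss_quot q k i
              + q ^+ i * ((q ^+ (n - k) - 1) / (q ^+ i - 1)) * gauss q k i)
             * q ^+ (i * (i - 1)) * gauss q (n - k - 1) (i - 1)
           else
             x * gauss q (n - k - 1) (i - 1) * gauss q k.+1 i
             * q ^+ (i * (i - 1));
       (* 7 *) forall S T : {set kspace F n k},
         conjugate_switching_sets S T -> #|L :&: S| = #|L :&: T| ]
  /\
  ((exists S : {set kspace F n k}, spread S) ->
   [<-> (* 1 *) chi \in limg (linfun (mulmx A^T : 'cV_ _ -> 'cV_ _));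
        (* 8 *) forall S : {set kspace F n k},
          spread S -> #|L :&: S|%:R = x;
        (* 9 *) forall S : {set kspace F n k},
          regular_spread S -> #|L :&: S|%:R = x ]).

Proof.
move=> q qR A chi V.
have card_L : #|L|%:R = (ratr x : R) * gauss qR n k.
  by rewrite -ratr_gauss -rmorphM /= -hx ratr_nat.
have ratrP (a b : rat) : a = b <-> (ratr a : R) = ratr b.
  by split=> [-> | /fmorph_inj].
have E1 := in_im_limgP R L.
have E2 := in_im_orthP R L.
have E3 : in_im (fun U => (U \in L)%:R : R) <-> (forall U : kspace F n k,
    #|[set W in L | skew_spaces U W]|%:R
      = (x - (U \in L)%:R) * gauss q (n - k - 1) k * q ^+ (k ^ 2 + k)).
  apply: iff_trans (in_im_skewP hn card_L) _.
  have toR U : ratr ((x - (U \in L)%:R) * gauss q (n - k - 1) k * q ^+ (k ^ 2 + k))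
      = (ratr x - (U \in L)%:R) * gauss qR (n - k - 1) k * qR ^+ (k ^ 2 + k) :> R.
    by rewrite !rmorphM rmorphB rmorphXn /= !ratr_nat ratr_gauss.
  split=> rel U; first by apply/ratrP; rewrite ratr_nat toR; apply: rel.
  by have /ratrP := rel U; rewrite ratr_nat toR.
have E6 : in_im (fun U => (U \in L)%:R : R) <-> (forall U : kspace F n k,
    #|[set W in L | grass_rel i U W]|%:R
      = if U \in L then
          ((x - 1) * gauss_quot q k i
            + q ^+ i * ((q ^+ (n - k) - 1) / (q ^+ i - 1)) * gauss q k i)
          * q ^+ (i * (i - 1)) * gauss q (n - k - 1) (i - 1)
        else
          x * gauss q (n - k - 1) (i - 1) * gauss q k.+1 i
          * q ^+ (i * (i - 1))).
  apply: iff_trans (in_im_grassP hn card_L hi) _.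
  have toR U : ratr (if U \in L then
        ((x - 1) * gauss_quot q k i
          + q ^+ i * ((q ^+ (n - k) - 1) / (q ^+ i - 1)) * gauss q k i)
        * q ^+ (i * (i - 1)) * gauss q (n - k - 1) (i - 1)
      else x * gauss q (n - k - 1) (i - 1) * gauss q k.+1 i * q ^+ (i * (i - 1)))
    = (if U \in L then
        ((ratr x - 1) * gauss_quot qR k i
          + qR ^+ i * ((qR ^+ (n - k) - 1) / (qR ^+ i - 1)) * gauss qR k i)
        * qR ^+ (i * (i - 1)) * gauss qR (n - k - 1) (i - 1)
      else ratr x * gauss qR (n - k - 1) (i - 1) * gauss qR k.+1 i * qR ^+ (i * (i - 1))) :> R.
    case: ifP => _; last by rewrite !rmorphM rmorphXn /= ratr_nat !ratr_gauss.
    rewrite !rmorphM rmorphD !rmorphM fmorphV !rmorphB !rmorphXn /= rmorph1.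
    by rewrite ratr_nat ratr_gauss_quot !ratr_gauss.
  split=> rel U; first by apply/ratrP; rewrite ratr_nat toR; apply: rel.
  by have /ratrP := rel U; rewrite ratr_nat toR.
have E7 : in_im (fun U => (U \in L)%:R : R) <-> (forall S T : {set kspace F n k},
    conjugate_switching_sets S T -> #|L :&: S| = #|L :&: T|).
  by split; [apply: in_im_switching | apply: switching_in_im].
have V1 := in_im_V1 hn card_L.
have V0 := all_one_V0 R F hn.
split.
  tfae.
  - by move/E1/E2.
  - by move/E2/E3.
  - by move/E3/V1.
  - set w := _ *: _ => V1f; rewrite -(subrKC w chi).
    exact: memv_add (memvZ _ V0) V1f.
  - by move/(in_im_V0V1 hn)/E6.
  - by move/E6/E7.
  - by move/E7/E1.
have toR S : (#|L :&: S|%:R = x) <-> (#|L :&: S|%:R = ratr x :> R).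
  by apply: iff_trans (ratrP _ _) _; rewrite ratr_nat.
move=> exS; tfae.
- by move/E1/(in_im_spread hn card_L) => im_S S /im_S/toR.
- by move=> meet_S S /regular_spread_is_spread/meet_S.
move=> meet_S; apply/E1; apply: (regular_spread_in_im hn exS) => S regS.
exact/toR/meet_S.
Qed.
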